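(* Let $\tilde p\neq 0$ be an integer and $\tilde q$ a positive integer with $\tilde q\geqslant 97|\tilde p|$. Consider the polynomial in $t$ $$P(t)=Q_{p\,q}(t)\quad\text{with } p=\tilde p+\tilde q,\ q=\tilde q,$$ where $$Q_{p q}(t)=t^{10}+(2q^2+p^2)(3q^2-2p^2)t^8+(q^8+10p^2q^6+4p^4q^4-14p^6q^2+p^8)t^6-p^2q^2(q^8-14p^2q^6+4p^4q^4+10p^6q^2+p^8)t^4-p^6q^6(q^2+2p^2)(3p^2-2q^2)t^2-q^{10}p^{10}.$$ Put $A=\tilde q^{2}+5\tilde p\tilde q+10\tilde p^{2}$ and let $I$ be the real interval $(A-74|\tilde p|^3/\tilde q,\ A)$ if $\tilde p>0$, and $(A,\ A+74|\tilde p|^3/\tilde q)$ if $\tilde p<0$. Let $u_2,u_3,u_4,u_5$ be the roots of $u^4+8u^2-12\,i\,u-4=0$ ($i=\sqrt{-1}$) and for $k=2,\dots,5$ let $$D_k=\Bigl\{t\in\mathbb C:\ \Bigl|\,t-i\,\tilde q^{2}-u_k\,\tilde p\,\tilde q+\frac{u_k+i\,u_k^2}{2}\,\tilde p^{2}\Bigr|<\frac{51|\tilde p|^3}{\tilde q}\Bigr\}.$$ Then the roots $t$ of $P$ satisfying the condition ''$t$ is real and $t>0$, or $t$ is non-real and $\operatorname{Im} t>0$'' are exactly five roots $t_1,\dots,t_5$; these are simple roots of $P$, and they are located in the five pairwise disjoint sets $I, D_2, D_3, D_4, D_5$, one root in each set. *)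

(* Defs.v *)
From HB Require Import structures.
From mathcomp Require Import all_boot all_order all_algebra.
From mathcomp Require Import all_classical reals.
From mathcomp Require Import complex.

Set Implicit Arguments.
Unset Strict Implicit.
Unset Printing Implicit Defensive.

Import Order.TTheory GRing.Theory Num.Theory.
Local Open Scope classical_set_scope.
Local Open Scope ring_scope.

Definition Qpoly (K : comNzRingType) (p q : K) : {poly K} :=
  'X^10
  + ((2 * q ^+ 2 + p ^+ 2) * (3 * q ^+ 2 - 2 * p ^+ 2)) *: 'X^8
  + (q ^+ 8 + 10 * p ^+ 2 * q ^+ 6 + 4 * p ^+ 4 * q ^+ 4
     - 14 * p ^+ 6 * q ^+ 2 + p ^+ 8) *: 'X^6
  - (p ^+ 2 * q ^+ 2
     * (q ^+ 8 - 14 * p ^+ 2 * q ^+ 6 + 4 * p ^+ 4 * q ^+ 4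
        + 10 * p ^+ 6 * q ^+ 2 + p ^+ 8)) *: 'X^4
  - (p ^+ 6 * q ^+ 6 * (q ^+ 2 + 2 * p ^+ 2)
     * (3 * p ^+ 2 - 2 * q ^+ 2)) *: 'X^2
  - (q ^+ 10 * p ^+ 10)%:P.

Section Localization.
Variable R : realType.

(* In this section p and q are the integers written \tilde p and \tilde q. *)

Definition P (p q : int) : {poly R[i]} := Qpoly (p + q)%:~R q%:~R.

Definition upoly : {poly R[i]} :=
  'X^4 + 8 *: 'X^2 - (12 * 'i%C) *: 'X - 4%:P.

Definition upper (t : R[i]) : Prop :=
  (complex.Im t = 0 /\ 0 < complex.Re t) \/
  (complex.Im t <> 0 /\ 0 < complex.Im t).

Definition A (p q : int) : R :=
  q%:~R ^+ 2 + 5 * p%:~R * q%:~R + 10 * p%:~R ^+ 2.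

Definition err (p q : int) : R := `|p%:~R| ^+ 3 / q%:~R.

Definition Iset (p q : int) : set R[i] :=
  (fun x : R => x%:C%C) @`
    (if 0 < p then `]A p q - 74 * err p q, A p q[%classic
     else `]A p q, A p q + 74 * err p q[%classic).

Definition Dset (p q : int) (u : R[i]) : set R[i] :=
  [set t | `| t - 'i%C * q%:~R ^+ 2 - u * p%:~R * q%:~R
             + (u + 'i%C * u ^+ 2) / 2 * p%:~R ^+ 2 |
           < (51 * err p q)%:C%C].

Definition region (p q : int) (u2 u3 u4 u5 : R[i]) (k : 'I_5) : set R[i] :=
  nth set0 [:: Iset p q; Dset p q u2; Dset p q u3; Dset p q u4; Dset p q u5] k.

End Localization.

(* Main.v *)
Require Import Defs.
From HB Require Import structures.
From Stdlib Require Import ZArith.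
From mathcomp Require Import all_boot all_order all_algebra.
From mathcomp Require Import all_classical reals.
From mathcomp Require Import complex separable.
From mathcomp Require Import ssrZ zify ring lra.

(* Put e = p~ / q~, t = q~^2 s and T = s^2. Then P becomes a quintic in T whose
   coefficients depend on e, which at e = 0 is (T - 1) (T + 1)^4. Write u = i v, so
   that v runs over the roots of W(v) = v^4 - 8 v^2 + 12 v - 4, and let T_v be the
   square of the center of D_u. Modulo W(v) the value of the quintic at T_v is
   O(e^6) and its derivative there is O(e^3); all the constants are obtained by
   computing in Z[v] / (W) and bounding the tail of each polynomial in e.
   Two of the roots v are real. For these, D_u is centered on the imaginary axis and
   the intermediate value theorem gives a root of P in it; it also gives the root in
   I. For the other two the error is so small that one can afford the crude
   estimate: a monic polynomial f of degree n has a root at distance at most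
   n |f(c) / f'(c)| from c.
   The five regions are disjoint and lie in the half plane that selects one of every
   pair t, -t. Since P is even of degree 10, it has no other roots than the five so
   found and their opposites, and these are simple. *)

Import Order.TTheory GRing.Theory Num.Theory.
Local Open Scope classical_set_scope.
Local Open Scope ring_scope.

Set Implicit Arguments.
Unset Strict Implicit.

Local Delimit Scope Z_scope with bZ.

(** * Computing in Z[e][v] / (v^4 - 8 v^2 + 12 v - 4) *)

Definition quartic (K : pzRingType) (v : K) := v ^+ 4 - 8 * v ^+ 2 + 12 * v - 4.

(* Large integers enter through their binary representation: the numerals of
   ring_scope are unary. *)
Fixpoint pos_ring (K : pzRingType) (n : positive) : K :=
  match n with
  | xH => 1
  | xO n => 2 * pos_ring K n
  | xI n => 1 + 2 * pos_ring K n
  end.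

Definition Z_ring (K : pzRingType) (z : Z) : K :=
  match z with
  | Z0 => 0
  | Zpos n => pos_ring K n
  | Zneg n => - pos_ring K n
  end.

Lemma Z_ringE (K : pzRingType) z : Z_ring K z = (int_of_Z z)%:~R.
Proof.
have posE n : pos_ring K n = (Pos.to_nat n)%:R.
  elim: n => [n IH|n IH|] //=; rewrite IH ?Pos2Nat.inj_xI ?Pos2Nat.inj_xO.
  - by rewrite -[X in _ = X%:R]/((2 * Pos.to_nat n).+1)%N -[RHS]natr1 natrM addrC.
  - by rewrite -[X in _ = X%:R]/(2 * Pos.to_nat n)%N natrM.
case: z => [|n|n] //=; rewrite posE //.
have n_gt0 : (0 < Pos.to_nat n)%N by apply/ssrnat.ltP; exact: Pos2Nat.is_pos.
by rewrite NegzE (prednK n_gt0) mulrNz.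
Qed.

Section ZRing.
Variable K : pzRingType.
Implicit Types x y : Z.

Lemma Z_ringD x y : Z_ring K (x + y)%bZ = Z_ring K x + Z_ring K y.
Proof. by rewrite !Z_ringE -intrD -rmorphD. Qed.
Lemma Z_ringM x y : Z_ring K (x * y)%bZ = Z_ring K x * Z_ring K y.
Proof. by rewrite !Z_ringE -intrM -rmorphM. Qed.
Lemma Z_ringN x : Z_ring K (- x)%bZ = - Z_ring K x.
Proof. by rewrite !Z_ringE -rmorphN -rmorphN. Qed.
Lemma Z_ringB x y : Z_ring K (x - y)%bZ = Z_ring K x - Z_ring K y.
Proof. by rewrite Z_ringD Z_ringN. Qed.

End ZRing.

Lemma Z_ring_abs (K : numDomainType) z : `|Z_ring K z| = Z_ring K (Z.abs z).
Proof. by rewrite !Z_ringE -intr_norm; congr (_ %:~R); lia. Qed.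

Lemma Z_ring_le (K : numDomainType) x y : (x <= y)%bZ -> Z_ring K x <= Z_ring K y.
Proof. by rewrite !Z_ringE ler_int; lia. Qed.

(* The element a + b v + c v^2 + d v^3 of Z[v] / (v^4 - 8 v^2 + 12 v - 4). *)
Definition quad := (Z * Z * Z * Z)%type.

Definition qadd (x y : quad) : quad :=
  let: (a, b, c, d) := x in let: (a', b', c', d') := y in
  (a + a', b + b', c + c', d + d')%bZ.
Definition qscale (k : Z) (x : quad) : quad :=
  let: (a, b, c, d) := x in (k * a, k * b, k * c, k * d)%bZ.
(** Multiplication by v, with v^4 replaced by 8 v^2 - 12 v + 4; [qmul] iterates it along Horner's
    scheme. *)
Definition qshift (x : quad) : quad :=
  let: (a, b, c, d) := x in (4 * d, a - 12 * d, b + 8 * d, c)%bZ.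
Definition qmul (x y : quad) : quad :=
  let: (a, b, c, d) := x in
  qadd (qscale a y) (qshift (qadd (qscale b y)
    (qshift (qadd (qscale c y) (qshift (qscale d y)))))).
Definition q0 : quad := (0, 0, 0, 0)%bZ.

(* Polynomials in e over that ring, constant coefficient first. *)
Definition tp := seq quad.

Definition tconst (k : Z) : tp := [:: (k, 0, 0, 0)%bZ].
Fixpoint tadd (x y : tp) : tp :=
  match x, y with
  | [::], _ => y
  | _, [::] => x
  | a :: x', b :: y' => qadd a b :: tadd x' y'
  end.
Fixpoint tmul (x y : tp) : tp :=
  if x is a :: x' then tadd (map (qmul a) y) (q0 :: tmul x' y) else [::].
Fixpoint tpow (x : tp) (n : nat) : tp :=
  if n is n'.+1 then tmul x (tpow x n') else tconst 1.

(** A formula is reified once and read in two ways: [tp_of] expands it by computation over Z,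
    [ev_expr] interprets it in a ring. The two readings agree at every root v of W, see
    [evt_expr]. *)
Inductive expr :=
  EConst of Z | EE | EV | EAdd of expr & expr | EMul of expr & expr
| EPow of expr & nat.

Fixpoint tp_of (x : expr) : tp :=
  match x with
  | EConst k => tconst k
  | EE => [:: q0; (1, 0, 0, 0)%bZ]
  | EV => [:: (0, 1, 0, 0)%bZ]
  | EAdd x y => tadd (tp_of x) (tp_of y)
  | EMul x y => tmul (tp_of x) (tp_of y)
  | EPow x n => tpow (tp_of x) n
  end.

Section Eval.
Variables (K : comPzRingType) (v e : K).
Hypothesis v_root : quartic v = 0.

Definition evq (x : quad) : K :=
  let: (a, b, c, d) := x in
  Z_ring K a + v * (Z_ring K b + v * (Z_ring K c + v * Z_ring K d)).

Fixpoint evt (x : tp) : K := if x is a :: x' then evq a + e * evt x' else 0.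

Lemma evqD x y : evq (qadd x y) = evq x + evq y.
Proof.
by move: x y => [[[a b] c] d] [[[a' b'] c'] d'] /=; rewrite !Z_ringD; ring.
Qed.

Lemma evqZ k x : evq (qscale k x) = Z_ring K k * evq x.
Proof. by move: x => [[[a b] c] d] /=; rewrite !Z_ringM; ring. Qed.

Lemma evq_shift x : evq (qshift x) = v * evq x.
Proof.
move: x => [[[a b] c] d]; rewrite /evq /qshift !(Z_ringD, Z_ringB, Z_ringM).
(* Subtracting d W(v) = 0 eliminates d v^4. *)
rewrite -[RHS](subr0) -[X in _ = _ - X](mulr0 (Z_ring K d)) -v_root /quartic /=; ring.
Qed.

Lemma evqM x y : evq (qmul x y) = evq x * evq y.
Proof.
move: x => [[[a b] c] d]; rewrite /qmul !(evqD, evqZ, evq_shift) /=; ring.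
Qed.

Lemma evtD x y : evt (tadd x y) = evt x + evt y.
Proof.
elim: x y => [|a x IH] [|b y] /=; rewrite ?add0r ?addr0 //.
by rewrite evqD IH; ring.
Qed.

Lemma evtM x y : evt (tmul x y) = evt x * evt y.
Proof.
elim: x => [|a x IH]; first by rewrite mul0r.
rewrite [tmul _ _]/= evtD [evt (_ :: tmul _ _)]/= IH.
have -> : evt [seq qmul a i | i <- y] = evq a * evt y.
  by elim: y {IH} => [|b y IHy] /=; rewrite ?mulr0 // evqM IHy; ring.
by rewrite /=; ring.
Qed.

Lemma evtX x n : evt (tpow x n) = evt x ^+ n.
Proof.
elim: n => [|n IH]; first by rewrite /= ; ring.
by rewrite [tpow _ _]/= evtM IH exprS.
Qed.

Fixpoint ev_expr (x : expr) : K :=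
  match x with
  | EConst k => Z_ring K k
  | EE => e
  | EV => v
  | EAdd x y => ev_expr x + ev_expr y
  | EMul x y => ev_expr x * ev_expr y
  | EPow x n => ev_expr x ^+ n
  end.

Lemma evt_expr x : evt (tp_of x) = ev_expr x.
Proof.
elim: x => [k|||x IHx y IHy|x IHx y IHy|x IHx n] /=; try ring.
- by rewrite evtD IHx IHy.
- by rewrite evtM IHx IHy.
- by rewrite evtX IHx.
Qed.

End Eval.

(* Bounds for the values when |v| <= m / 1000 and |e| <= 1 / 194; every division
   is rounded up to an integer. *)
Definition qbound (m : Z) (x : quad) : Z :=
  let: (a, b, c, d) := x in
  let up z := (m * z / 1000 + 1)%bZ in
  (Z.abs a + up (Z.abs b + up (Z.abs c + up (Z.abs d))))%bZ.
Fixpoint tbound (m : Z) (x : tp) : Z :=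
  if x is a :: x' then (qbound m a + (tbound m x' / 194 + 1))%bZ else 0%bZ.

(** The floor of m z / k plus 1 exceeds m z / k, so the bound survives the rounding. It serves for c
    = v with k = 1000 and for c = e with k = 194. *)
Lemma norm_mul_le_up (K : numFieldType) (k m z : Z) (c x : K) :
  (0 < k)%bZ -> (0 <= m)%bZ -> Z_ring K k * `|c| <= Z_ring K m ->
  `|x| <= Z_ring K z -> `|c * x| <= Z_ring K (m * z / k + 1)%bZ.
Proof.
move=> k_gt0 m_ge0 c_le x_le.
have k0 : 0 < Z_ring K k by rewrite Z_ringE ltr0z; lia.
rewrite -(ler_pM2l k0) normrM mulrA.
have kc_ge0 : 0 <= Z_ring K k * `|c| by rewrite mulr_ge0 // ltW.
apply: le_trans (ler_pM kc_ge0 (normr_ge0 x) c_le x_le) _.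
rewrite -!Z_ringM; apply: Z_ring_le.
have := Z.mul_succ_div_gt (m * z) k; lia.
Qed.

Section Bound.
Variables (K : numFieldType) (v e : K) (m : Z).
Hypothesis m_ge0 : (0 <= m)%bZ.
Hypothesis v_le : Z_ring K 1000 * `|v| <= Z_ring K m.
Hypothesis e_le : Z_ring K 194 * `|e| <= Z_ring K 1.

Lemma evq_le x : `|evq v x| <= Z_ring K (qbound m x).
Proof.
have step a y z : `|y| <= Z_ring K z ->
    `|Z_ring K a + v * y| <= Z_ring K (Z.abs a + (m * z / 1000 + 1))%bZ.
  move=> yz; rewrite Z_ringD -Z_ring_abs; apply: le_trans (ler_normD _ _) _.
  by rewrite lerD2l; apply: norm_mul_le_up.
move: x => [[[a b] c] d]; rewrite /evq /qbound.
by do 3!apply: (step); rewrite Z_ring_abs.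
Qed.

Lemma evt_le x : `|evt v e x| <= Z_ring K (tbound m x).
Proof.
elim: x => [|a x IH]; first by rewrite normr0.
rewrite [evt _ _ _]/= [tbound _ _]/= Z_ringD.
apply: le_trans (ler_normD _ _) _; apply: lerD; first exact: evq_le.
by have := norm_mul_le_up _ _ e_le IH; rewrite Z.mul_1_l; apply.
Qed.
End Bound.

(** * The quintic *)

(* Q_{p 1}(t) is a quintic in T = t^2: quint0 is its value, and quint1, ..., quint4
   are its divided derivatives, see quint0D. *)
Section Quintic.
Variables (K : comPzRingType) (p T : K).

Let c4 := (2 + p ^+ 2) * (3 - 2 * p ^+ 2).
Let c3 := 1 + 10 * p ^+ 2 + 4 * p ^+ 4 - 14 * p ^+ 6 + p ^+ 8.
Let c2 := - (p ^+ 2 * (1 - 14 * p ^+ 2 + 4 * p ^+ 4 + 10 * p ^+ 6 + p ^+ 8)).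
Let c1 := - (p ^+ 6 * (1 + 2 * p ^+ 2) * (3 * p ^+ 2 - 2)).

Definition quint0 := T ^+ 5 + c4 * T ^+ 4 + c3 * T ^+ 3 + c2 * T ^+ 2 + c1 * T
  - p ^+ 10.
Definition quint1 :=
  5 * T ^+ 4 + 4 * c4 * T ^+ 3 + 3 * c3 * T ^+ 2 + 2 * c2 * T + c1.
Definition quint2 := 10 * T ^+ 3 + 6 * c4 * T ^+ 2 + 3 * c3 * T + c2.
Definition quint3 := 10 * T ^+ 2 + 4 * c4 * T + c3.
Definition quint4 := 5 * T + c4.
End Quintic.

Lemma quint0D (K : comPzRingType) (p T h : K) :
  quint0 p (T + h) = quint0 p T + quint1 p T * h + quint2 p T * h ^+ 2
    + quint3 p T * h ^+ 3 + quint4 p T * h ^+ 4 + h ^+ 5.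
Proof. rewrite /quint0 /quint1 /quint2 /quint3 /quint4; ring. Qed.

Declare Scope expr_scope.
Delimit Scope expr_scope with expr.
Notation "x + y" := (EAdd x y) : expr_scope.
Notation "x * y" := (EMul x y) : expr_scope.
Notation "x ^+ n" := (EPow x n) : expr_scope.
Notation "# k" := (EConst k) (at level 5, k at level 0) : expr_scope.

Section TQuintic.
Variable T : expr.
Local Open Scope expr_scope.
(** This is (p~ + q~) / q~, as e stands for p~ / (2 q~). *)
Let p := #1 + #2 * EE.
Let c4 := (#2 + p ^+ 2) * (#3 + #(-2) * p ^+ 2).
Let c3 := #1 + #10 * p ^+ 2 + #4 * p ^+ 4 + #(-14) * p ^+ 6 + p ^+ 8.
Let c2 := #(-1) * (p ^+ 2 *
  (#1 + #(-14) * p ^+ 2 + #4 * p ^+ 4 + #10 * p ^+ 6 + p ^+ 8)).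
Let c1 := #(-1) * (p ^+ 6 * (#1 + #2 * p ^+ 2) * (#3 * p ^+ 2 + #(-2))).

Definition equint0 := T ^+ 5 + c4 * T ^+ 4 + c3 * T ^+ 3 + c2 * T ^+ 2 + c1 * T
  + #(-1) * p ^+ 10.
Definition equint1 :=
  #5 * T ^+ 4 + #4 * c4 * T ^+ 3 + #3 * c3 * T ^+ 2 + #2 * c2 * T + c1.
Definition equint2 := #10 * T ^+ 3 + #6 * c4 * T ^+ 2 + #3 * c3 * T + c2.
Definition equint3 := #10 * T ^+ 2 + #4 * c4 * T + c3.
Definition equint4 := #5 * T + c4.
End TQuintic.

Section TQuinticEval.
Variables (K : comPzRingType) (v e : K) (T : expr).
Local Notation ev := (ev_expr v e).
Local Notation p := (1 + 2 * e).

Lemma ev_expr_quint : [/\ ev (equint0 T) = quint0 p (ev T),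
  ev (equint1 T) = quint1 p (ev T), ev (equint2 T) = quint2 p (ev T),
  ev (equint3 T) = quint3 p (ev T) & ev (equint4 T) = quint4 p (ev T)].
Proof.
rewrite /equint0 /equint1 /equint2 /equint3 /equint4 /=.
by rewrite /quint0 /quint1 /quint2 /quint3 /quint4; split; ring.
Qed.
End TQuinticEval.

(* T_v, with the e of the header halved to avoid denominators, see ev_eT. *)
Definition eT : expr :=
  (#(-1) * (#1 + #2 * EV * EE + #2 * (EV ^+ 2 + #(-1) * EV) * EE ^+ 2) ^+ 2)%expr.

Section TQuinticBound.
Variables (K : numFieldType) (v e : K) (m : Z).
Hypothesis v_root : quartic v = 0.
Hypothesis m_ge0 : (0 <= m)%bZ.
Hypothesis v_le : Z_ring K 1000 * `|v| <= Z_ring K m.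
Hypothesis e_le : Z_ring K 194 * `|e| <= Z_ring K 1.

(* The first n coefficients of x in e vanish and the next ones are those in l. *)
Lemma ev_expr_head x n l M : (tbound m (drop (n + size l) (tp_of x)) <= M)%bZ ->
  take (n + size l) (tp_of x) = nseq n q0 ++ l ->
  exists2 r, ev_expr v e x = e ^+ n * foldr (fun a y => evq v a + e * y) r l
    & `|r| <= Z_ring K M.
Proof.
(* The remainder r is the value of the coefficients beyond the head. *)
move=> bM hd; exists (evt v e (drop (n + size l) (tp_of x))); last first.
  by apply: le_trans (Z_ring_le K bM); apply: evt_le.
rewrite -(evt_expr e v_root) -[in LHS](cat_take_drop (n + size l) (tp_of x)) hd.
elim: n {bM hd} (drop _ _) => [|n IH] t /=.
  by rewrite mul1r; elim: l => //= a l ->.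
by rewrite IH exprS; ring.
Qed.
End TQuinticBound.

(** * Roots on the coordinate axes *)

Lemma poly_ivt_strict (R : rcfType) (f : {poly R}) a b :
  a <= b -> f.[a] * f.[b] < 0 -> exists2 x, a < x < b & f.[x] = 0.
Proof.
wlog fa : f / f.[a] < 0 => [hw|] ab fab.
  case: (ltP f.[a] 0) => fa; first exact: hw.
  have [|||x xab /eqP] := hw (- f); rewrite ?hornerN ?mulrNN //.
    rewrite oppr_lt0 lt_neqAle fa andbT.
    by apply: contraTneq fab => <-; rewrite mul0r ltxx.
  by rewrite oppr_eq0 => /eqP; exists x.
have fb : 0 < f.[b] by move: fab; rewrite nmulr_rlt0.
have [|x /andP[ax xb] /eqP fx] := @poly_ivt R f a b ab; first by rewrite !ltW.
exists x => //; rewrite !lt_neqAle ax xb !andbT; apply/andP; split.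
  by apply: contraTneq fa => ->; rewrite fx ltxx.
by apply: contraTneq fb => <-; rewrite fx ltxx.
Qed.

(* The real roots are -3.4391091... and 0.4863801... *)
Definition negative_root_interval (R : realFieldType) (v : R) :=
  - (3 + 439 / 1000 + 11 / 100 / 1000) < v < - (3 + 439 / 1000 + 1 / 10 / 1000).
Definition positive_root_interval (R : realFieldType) (v : R) :=
  486 / 1000 + 38 / 100 / 1000 < v < 486 / 1000 + 39 / 100 / 1000.

Lemma quartic_real_roots (R : rcfType) : exists w0 w1 : R,
  [/\ quartic w0 = 0, negative_root_interval w0,
      quartic w1 = 0 & positive_root_interval w1].
Proof.
pose f : {poly R} := 'X^4 - 8 *: 'X^2 + 12 *: 'X - 4%:P.
have fE x : f.[x] = quartic x.
  by rewrite /f !(hornerD, hornerN, hornerZ, hornerXn, hornerX, hornerC).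
(* The ends are -3.43911 and -3.4391; they are written as sums of fractions to keep the unary
   numerals small. *)
have [||w0 w0I w0r] := @poly_ivt_strict R f
  (- (3 + 439 / 1000 + 11 / 100 / 1000)) (- (3 + 439 / 1000 + 1 / 10 / 1000)).
- by lra.
- by rewrite !fE /quartic; lra.
have [||w1 w1I w1r] := @poly_ivt_strict R f
  (486 / 1000 + 38 / 100 / 1000) (486 / 1000 + 39 / 100 / 1000).
- by lra.
- by rewrite !fE /quartic; lra.
by exists w0, w1; split; rewrite -?fE.
Qed.

(** It turns the bound on a tail r into linear inequalities on the product e r, which [lra] can use
    as an atom. *)
Lemma norm_mul_le_div (R : realFieldType) (e r M : R) : 194 * `|e| <= 1 ->
  `|r| <= M -> - M <= 194 * (e * r) <= M.
Proof.
move=> e_le rM; rewrite -ler_norml; apply: le_trans rM.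
by rewrite !normrM ger0_norm // mulrA -[leRHS]mul1r; apply: ler_wpM2r.
Qed.

Lemma normXM (R : numDomainType) (e x : R) n : `|e ^+ n * x| = `|e| ^+ n * `|x|.
Proof. by rewrite normrM normrX. Qed.

Section RealHead.
Variables (R : realFieldType) (v e : R).
Hypothesis v_root : quartic v = 0.
Hypothesis v_le : 1000 * `|v| <= 3440.
Hypothesis e_le : 194 * `|e| <= 1.

Lemma ev_expr_head_real x n l M :
  (tbound 3440 (drop (n + size l) (tp_of x)) <= M)%bZ ->
  take (n + size l) (tp_of x) = nseq n q0 ++ l ->
  exists2 r, ev_expr v e x = e ^+ n * foldr (fun a y => evq v a + e * y) r l
    & `|r| <= Z_ring R M.
Proof.
apply: (@ev_expr_head R v e 3440%bZ) => //.
  by apply: le_trans (le_trans v_le _); rewrite /Z_ring /=; lra.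
by apply: le_trans (le_trans e_le _); rewrite /Z_ring /=; lra.
Qed.

(** For e = 0 the root T = 1 of (T - 1) (T + 1)^4 is simple, with derivative 16. At the end A of I
    the quintic is e^3 (9728 + O(e)); subtracting 592 e^3 lowers T by 1184 e^3 up to higher order,
    and the coefficient by 16 * 1184 to -9216. The tails contribute less than 3700. The factor e
    makes the signs independent of the sign of e. *)
Lemma real_interval_signs : e != 0 ->
  0 < e * quint0 (1 + 2 * e) ((1 + 10 * e + 40 * e ^+ 2) ^+ 2) /\
  e * quint0 (1 + 2 * e) ((1 + 10 * e + 40 * e ^+ 2 - 592 * e ^+ 3) ^+ 2) < 0.
Proof.
move=> e0.
have e4 : 0 < e ^+ 4 by rewrite -[4%N]/(2 * 2)%N exprM exprn_even_gt0 // sqrf_eq0.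
pose eA := (#1 + #10 * EE + #40 * EE ^+ 2)%expr.
split.
  have [||r] := @ev_expr_head_real (equint0 (eA ^+ 2)%expr) 3
    [:: (9728, 0, 0, 0)%bZ] 700000; first by vm_compute.
    by vm_compute.
  have [-> _ _ _ _] := ev_expr_quint v e (eA ^+ 2)%expr.
  have -> : ev_expr v e (eA ^+ 2)%expr = (1 + 10 * e + 40 * e ^+ 2) ^+ 2.
    by rewrite /=; ring.
  move=> -> /(norm_mul_le_div e_le) /andP[r1 r2]; rewrite /= in r1 r2 *.
  rewrite mulrA -exprS; apply: mulr_gt0 => //; lra.
have [||r] := @ev_expr_head_real (equint0 ((eA + #(-592) * EE ^+ 3) ^+ 2)%expr) 3
    [:: (-9216, 0, 0, 0)%bZ] 700000; first by vm_compute.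
  by vm_compute.
have [-> _ _ _ _] := ev_expr_quint v e ((eA + #(-592) * EE ^+ 3) ^+ 2)%expr.
have -> : ev_expr v e ((eA + #(-592) * EE ^+ 3) ^+ 2)%expr
   = (1 + 10 * e + 40 * e ^+ 2 - 592 * e ^+ 3) ^+ 2.
  by rewrite /=; ring.
move=> -> /(norm_mul_le_div e_le) /andP[r1 r2]; rewrite /= in r1 r2 *.
rewrite mulrA -exprS; rewrite pmulr_rlt0 //; lra.
Qed.
End RealHead.

(** When the linear term dominates at distance H, the values at H and -H have the signs of a1 and
    -a1, and the intermediate value theorem applies. *)
Lemma dominant_linear_term_root (R : rcfType) (a0 a1 a2 a3 a4 H : R) : 0 < H ->
  `|a0| + `|a2| * H ^+ 2 + `|a3| * H ^+ 3 + `|a4| * H ^+ 4 + H ^+ 5 < `|a1| * H ->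
  exists2 h, `|h| < H &
    a0 + a1 * h + a2 * h ^+ 2 + a3 * h ^+ 3 + a4 * h ^+ 4 + h ^+ 5 = 0.
Proof.
move=> H0 dom.
pose f : {poly R} := a0%:P + a1 *: 'X + a2 *: 'X^2 + a3 *: 'X^3 + a4 *: 'X^4 + 'X^5.
have fE x : f.[x] = a0 + a1 * x + a2 * x ^+ 2 + a3 * x ^+ 3 + a4 * x ^+ 4 + x ^+ 5.
  by rewrite /f !(hornerD, hornerN, hornerZ, hornerXn, hornerX, hornerC).
have [||h hH fh] := @poly_ivt_strict R f (- H) H; last first.
- by exists h; [rewrite ltr_norml | rewrite -fE].
- rewrite !fE.
  have b a n : - (`|a| * H ^+ n) <= a * H ^+ n <= `|a| * H ^+ n.
    by rewrite -ler_norml normrM (ger0_norm (exprn_ge0 n (ltW H0))).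
  have /andP[l0 u0] := b a0 0%N.
  have /andP[l2 u2] := b a2 2%N; have /andP[l3 u3] := b a3 3%N.
  have /andP[l4 u4] := b a4 4%N; rewrite !expr0 !mulr1 in l0 u0.
  have H5 := exprn_gt0 5 H0.
  have -> : (- H) ^+ 2 = H ^+ 2 by ring.
  have -> : (- H) ^+ 3 = - H ^+ 3 by ring.
  have -> : (- H) ^+ 4 = H ^+ 4 by ring.
  have -> : (- H) ^+ 5 = - H ^+ 5 by ring.
  case: (ler0P a1) dom => a1s dom.
    by rewrite nmulr_llt0; lra.
  by rewrite pmulr_llt0; lra.
- by lra.
Qed.

(* With e = p~ / (2 q~) and u = i v, the center of the disc D_u is
   q~^2 i (center v e). *)
Definition center (K : pzRingType) (v e : K) :=
  1 + 2 * v * e + 2 * (v ^+ 2 - v) * e ^+ 2.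

Lemma ev_eT (K : comPzRingType) (v e : K) :
  ev_expr v e eT = - center v e ^+ 2.
Proof. by rewrite /= /center; ring. Qed.

Section RealQuarticRoot.
Variables (R : rcfType) (v e alpha beta : R).
Hypothesis v_root : quartic v = 0.
Hypothesis v_le : 1000 * `|v| <= 3440.
Hypothesis e_le : 194 * `|e| <= 1.
Hypothesis e_neq0 : e != 0.

Let X := center v e.

Let a0 := quint0 (1 + 2 * e) (- X ^+ 2).
Let a1 := quint1 (1 + 2 * e) (- X ^+ 2).
Hypothesis a0_le : `|a0| <= alpha * `|e| ^+ 6.
Hypothesis a1_ge : beta * `|e| ^+ 3 <= `|a1|.
Hypothesis alpha_beta : alpha + 65 * 1000 < 768 * beta.

(** The Taylor expansion at -X^2 is dominated by its linear term for H = 768 |e|^3. After division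
    by |e|^6 the two sides become alpha plus at most 65000, and at least 768 beta. *)
Lemma real_quint_root : exists2 h, `|h| < 768 * `|e| ^+ 3 &
  quint0 (1 + 2 * e) (- X ^+ 2 + h) = 0.
Proof.
have [_ _ q2 q3 q4] := ev_expr_quint v e eT.
rewrite ev_eT in q2 q3 q4.
(* For e = 0 the point T = -1 is a quadruple root, so the divided derivatives of orders 2, 3, 4 at
   T_v are O(e^2), O(e), O(1). *)
have [||r2 e2 l2] := @ev_expr_head_real R v e v_root v_le e_le (equint2 eT) 2 [::] 3050.
- by vm_compute.
- by vm_compute.
have [||r3 e3 l3] := @ev_expr_head_real R v e v_root v_le e_le (equint3 eT) 1 [::] 150.
- by vm_compute.
- by vm_compute.
have [||r4 e4 l4] := @ev_expr_head_real R v e v_root v_le e_le (equint4 eT) 0 [::] 20.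
- by vm_compute.
- by vm_compute.
rewrite q2 [foldr _ _ _]/= in e2; rewrite q3 [foldr _ _ _]/= in e3.
rewrite q4 [foldr _ _ _]/= in e4; rewrite /= in l2 l3 l4; move=> {q2 q3 q4}.
have eta0 : 0 < `|e| by rewrite normr_gt0.
move: a0_le a1_ge eta0 e_le; set eta : R := `|e| => A0 A1 eta0 eta_le.
have [|| h hH hr] := @dominant_linear_term_root R a0 a1 (e ^+ 2 * r2) (e ^+ 1 * r3)
   (e ^+ 0 * r4) (768 * eta ^+ 3).
- by rewrite mulr_gt0 // exprn_gt0.
- rewrite !normrM !normrX -/eta.
  have z_ge0 : 0 <= 768 * eta by lra.
  have z_le : 768 * eta <= 4 by lra.
  have pow_le n : (768 * eta) ^+ n <= 4 ^+ n
    by apply: lerXn2r; rewrite ?nnegrE //; lra.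
  have eta1 : eta <= 1 by lra.
  have eta_ge0 := ltW eta0.
  (* Each power of H leaves a factor 768 eta, which is at most 768 / 194 < 4. *)
  have tail (r M : R) n k : `|r| <= M ->
      `|r| * (768 * eta) ^+ n * eta ^+ k <= M * 4 ^+ n.
    move=> rM; rewrite -[leRHS]mulr1.
    apply: ler_pM; rewrite ?mulr_ge0 ?exprn_ge0 //; last exact: exprn_ile1.
    by apply: ler_pM (pow_le _) => //; apply: exprn_ge0.
  have t2 := tail _ _ 2%N 0%N l2; have t3 := tail _ _ 3%N 1%N l3.
  have t4 := tail _ _ 4%N 2%N l4; have t5 := tail 1 1 5%N 4%N.
  rewrite normr1 in t5; move: {t5}(t5 (lexx _)) => t5.
  have eta6 : 0 < eta ^+ 6 by exact: exprn_gt0.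
  pose rest := `|r2| * (768 * eta) ^+ 2 * eta ^+ 0
      + `|r3| * (768 * eta) ^+ 3 * eta ^+ 1 + `|r4| * (768 * eta) ^+ 4 * eta ^+ 2
      + 1 * (768 * eta) ^+ 5 * eta ^+ 4.
  (* The four terms are at most 48800, 9600, 5120 and 1024. *)
  have rest_le : rest <= 65 * 1000.
    apply: le_trans (lerD (lerD (lerD t2 t3) t4) t5) _; lra.
  have step : eta ^+ 6 * (alpha + rest) < eta ^+ 6 * (768 * beta).
    by rewrite ltr_pM2l //; apply: le_lt_trans alpha_beta; rewrite lerD2l.
  have A1' := ler_wpM2r (ltW (mulr_gt0 (ltr0n R 768) (exprn_gt0 3 eta0))) A1.
  apply: lt_le_trans A1'.
  have -> : beta * eta ^+ 3 * (768 * eta ^+ 3) = eta ^+ 6 * (768 * beta) by ring.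
  apply: le_lt_trans step.
  rewrite -!addrA [leRHS]mulrDr; apply: lerD; first by rewrite mulrC.
  rewrite /rest.
  by rewrite le_eqVlt; apply/orP; left; apply/eqP; ring.
exists h => //.
by rewrite quint0D -[RHS]hr e2 e3 e4.
Qed.
End RealQuarticRoot.

(** Since T_v + 1 = -4 v e + O(e^2), the quintic starts with -512 W(v) e^4. Modulo W the coefficient
    of e^5 vanishes too, and the derivative starts with 128 W'(v) e^3. This is the tight case: the
    ratio of the two bounds is about 710 |e|^3, where 768 |e|^3 is allowed. *)
Lemma negative_root_quint_bounds (R : rcfType) (v e : R) : quartic v = 0 ->
  negative_root_interval v ->
  194 * `|e| <= 1 ->
  `|quint0 (1 + 2 * e) (- center v e ^+ 2)| <= 7950 * 1000 * `|e| ^+ 6 /\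
  112 * 100 * `|e| ^+ 3 <= `|quint1 (1 + 2 * e) (- center v e ^+ 2)|.
Proof.
move=> v_root /andP[vl vu] e_le.
have v2 : 11 + 827 / 1000 + 4 / 10 / 1000 <= v ^+ 2
    <= 11 + 827 / 1000 + 48 / 100 / 1000.
  by clear - vl vu; apply/andP; split; nra.
have v3 : - (40 + 676 / 1000) <= v ^+ 3 <= - (40 + 675 / 1000 + 6 / 10 / 1000).
  by clear - vl vu v2; case/andP: v2 => v2l v2u; rewrite exprS; apply/andP; split; nra.
move: v2 v3 => /andP[v2l v2u] /andP[v3l v3u].
have v_le : 1000 * `|v| <= 3440 by rewrite ltr0_norm; lra.
have [q0 q1 _ _ _] := ev_expr_quint v e eT; rewrite ev_eT in q0 q1.
have [||r0] := @ev_expr_head_real R v e v_root v_le e_le (equint0 eT) 6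
  [:: (-81920, 270336, -241664, 69632)%bZ] 241451610%bZ.
- by vm_compute.
- by vm_compute.
rewrite q0 [foldr _ _ _]/= => -> r0_le {q0}.
(* The coefficient of e^4 is kept apart and estimated at the root itself: with the tail it takes at
   most 1000 |e|^3 from a leading term of about 12250 |e|^3. *)
have [||r1] := @ev_expr_head_real R v e v_root v_le e_le (equint1 eT) 3
  [:: (1536, -2048, 0, 512)%bZ; (23040, -41984, 12288, 3584)%bZ] 5132992%bZ.
- by vm_compute.
- by vm_compute.
rewrite q1 [foldr _ _ _]/= => -> r1_le {q1}; rewrite !normXM; split.
  rewrite mulrC; apply: ler_wpM2r; first exact: exprn_ge0.
  have /andP[l u] := norm_mul_le_div e_le r0_le; rewrite /= in l u.
  by rewrite ler_norml /=; clear - l u vl vu v2l v2u v3l v3u; apply/andP; split; lra.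
rewrite mulrC; apply: ler_wpM2l; first exact: exprn_ge0.
have /andP[l u] := norm_mul_le_div e_le r1_le; rewrite /= in l u.
have q_le : `|evq v (23040, -41984, 12288, 3584)%bZ + e * r1| <= 194 * 1000.
  by rewrite ler_norml /=; clear - l u vl vu v2l v2u v3l v3u; apply/andP; split; lra.
have /andP[] := norm_mul_le_div e_le q_le.
set q := _ + e * r1; move=> l' u'.
rewrite -normrN; apply: le_trans (ler_norm _).
by clear - l' u' vl vu v2l v2u v3l v3u; lra.
Qed.

Lemma positive_root_quint_bounds (R : rcfType) (v e : R) : quartic v = 0 ->
  positive_root_interval v ->
  194 * `|e| <= 1 ->
  `|quint0 (1 + 2 * e) (- center v e ^+ 2)| <= 60 * 1000 * `|e| ^+ 6 /\
  300 * `|e| ^+ 3 <= `|quint1 (1 + 2 * e) (- center v e ^+ 2)|.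
Proof.
move=> v_root /andP[vl vu] e_le.
have v2 : 236 / 1000 <= v ^+ 2 <= 237 / 1000.
  by clear - vl vu; apply/andP; split; nra.
have v3 : 115 / 1000 <= v ^+ 3 <= 116 / 1000.
  by clear - vl vu v2; case/andP: v2 => v2l v2u; rewrite exprS; apply/andP; split; nra.
move: v2 v3 => /andP[v2l v2u] /andP[v3l v3u].
(* The derivative starts with only about 600 e^3 here, so the tails need the sharper bound |v| <=
   0.487. *)
have v_le : Z_ring R 1000 * `|v| <= Z_ring R 487 by rewrite gtr0_norm /=; lra.
have e_le' : Z_ring R 194 * `|e| <= Z_ring R 1 by rewrite /=; lra.
have [q0 q1 _ _ _] := ev_expr_quint v e eT; rewrite ev_eT in q0 q1.
have [||r0] := @ev_expr_head R v e 487 v_root (Zle_0_pos 487) v_le e_le' (equint0 eT) 6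
  [:: (-81920, 270336, -241664, 69632)%bZ] 9940808%bZ.
- by vm_compute.
- by vm_compute.
rewrite q0 [foldr _ _ _]/= => -> r0_le {q0}.
have [||r1] := @ev_expr_head R v e 487 v_root (Zle_0_pos 487) v_le e_le' (equint1 eT) 3
  [:: (1536, -2048, 0, 512)%bZ] 47606%bZ.
- by vm_compute.
- by vm_compute.
rewrite q1 [foldr _ _ _]/= => -> r1_le {q1}; rewrite !normXM; split.
  rewrite mulrC; apply: ler_wpM2r; first exact: exprn_ge0.
  have /andP[l u] := norm_mul_le_div e_le r0_le; rewrite /= in l u.
  by rewrite ler_norml /=; clear - l u vl vu v2l v2u v3l v3u; apply/andP; split; lra.
rewrite mulrC; apply: ler_wpM2l; first exact: exprn_ge0.
have /andP[l u] := norm_mul_le_div e_le r1_le; rewrite /= in l u.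
by apply: le_trans (ler_norm _); clear - l u vl vu v2l v2u v3l v3u; lra.
Qed.

Lemma imaginary_axis_root (R : rcfType) (v e : R) : quartic v = 0 ->
  negative_root_interval v || positive_root_interval v ->
  194 * `|e| <= 1 -> e != 0 ->
  exists y, [/\ 0 < y, `|y - center v e| < 408 * `|e| ^+ 3
    & quint0 (1 + 2 * e) (- y ^+ 2) = 0].
Proof.
move=> v_root vI e_le e0.
have v_le : 1000 * `|v| <= 3440.
  by case/orP: vI => /andP[l u]; [rewrite ltr0_norm | rewrite gtr0_norm]; lra.
have [h h_lt h_root] : exists2 h, `|h| < 768 * `|e| ^+ 3 &
    quint0 (1 + 2 * e) (- center v e ^+ 2 + h) = 0.
  case/orP: vI => vI.
    have [b0 b1] := negative_root_quint_bounds v_root vI e_le.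
    by apply: real_quint_root v_root v_le e_le e0 b0 b1 _; lra.
  have [b0 b1] := positive_root_quint_bounds v_root vI e_le.
  by apply: real_quint_root v_root v_le e_le e0 b0 b1 _; lra.
have e_small : `|e| <= 1 / 194 by lra.
have e3 : `|e| ^+ 3 <= (1 / 194) ^+ 3.
  by apply: lerXn2r; rewrite ?nnegrE //; lra.
have X_ge : 96 / 100 + 1 / 1000 <= center v e.
  have /andP[ve_l _] : - (3440 / 1000 / 194) <= v * e <= 3440 / 1000 / 194.
    rewrite -ler_norml normrM; have := normr_ge0 v; have := normr_ge0 e; nra.
  have e2 : 0 <= e ^+ 2 <= (1 / 194) ^+ 2.
    rewrite sqr_ge0 -[e ^+ 2]ger0_norm ?sqr_ge0 // normrX.
    by apply: lerXn2r; rewrite ?nnegrE //; lra.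
  have vv : - 1 <= v ^+ 2 - v by have := sqr_ge0 (v - 1 / 2); lra.
  rewrite /center; move: e2 => /andP[e2l e2u]; nra.
have /andP[h_l h_u] : - (1 / 1000) < h < 1 / 1000.
  by rewrite -ltr_norml; apply: lt_trans h_lt _; lra.
set X := center v e in X_ge h_root *.
have y2_ge : (96 / 100) ^+ 2 <= X ^+ 2 - h by nra.
have y2_ge0 : 0 <= X ^+ 2 - h by apply: le_trans y2_ge; rewrite sqr_ge0.
pose y := Num.sqrt (X ^+ 2 - h).
have yE : y ^+ 2 = X ^+ 2 - h by rewrite sqr_sqrtr.
have y_ge : 96 / 100 <= y.
  by rewrite -(@ler_pXn2r _ 2) ?nnegrE ?sqrtr_ge0 ?yE //; lra.
exists y; split; first by lra.
  (* As y + X >= 1.92, the bound 768 |e|^3 on h gives at most 400 |e|^3 for |y - X|. *)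
  have : `|y - X| * (y + X) = `|h|.
    rewrite -[y + X in LHS]ger0_norm; last by lra.
    have hE : h = X ^+ 2 - y ^+ 2 by rewrite yE; ring.
    by rewrite -normrM -normrN [in RHS]hE; congr `|_|; ring.
  have := normr_ge0 (y - X); nra.
by rewrite yE -[RHS]h_root; congr quint0; ring.
Qed.

(** * Roots off the axes *)

Section ComplexNorm.
Variable R : rcfType.
Implicit Types z : R[i].

(** The norm of R[i] takes its values in R[i]; [cnorm] is the same modulus in the ordered field R,
    where [lra] and [nra] apply. *)
Definition cnorm z : R := complex.Re `|z|.

Lemma cnormE z : `|z| = (cnorm z)%:C%C.
Proof. by rewrite /cnorm normc_def. Qed.

Lemma cnorm_def z : cnorm z = Num.sqrt (complex.Re z ^+ 2 + complex.Im z ^+ 2).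
Proof. by rewrite /cnorm normc_def. Qed.

Lemma cnorm_ge0 z : 0 <= cnorm z.
Proof. by rewrite cnorm_def sqrtr_ge0. Qed.

Lemma cnorm_gt0 z : (0 < cnorm z) = (z != 0).
Proof. by rewrite -ltcR -cnormE; exact: normr_gt0. Qed.

Lemma cnormD z1 z2 : cnorm (z1 + z2) <= cnorm z1 + cnorm z2.
Proof. by rewrite -lecR rmorphD /= -!cnormE ler_normD. Qed.

Lemma cnormM z1 z2 : cnorm (z1 * z2) = cnorm z1 * cnorm z2.
Proof. by apply: complexI; rewrite rmorphM /= -!cnormE normrM. Qed.

Lemma cnormX z n : cnorm (z ^+ n) = cnorm z ^+ n.
Proof. by apply: complexI; rewrite rmorphXn /= -!cnormE normrX. Qed.

Lemma cnormN z : cnorm (- z) = cnorm z.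
Proof. by rewrite /cnorm normrN. Qed.

Lemma cnorm_real (x : R) : cnorm x%:C%C = `|x|.
Proof. by rewrite cnorm_def /= expr0n addr0 sqrtr_sqr. Qed.

Lemma cnormi : cnorm 'i%C = 1.
Proof. by rewrite cnorm_def /= expr0n add0r expr1n sqrtr1. Qed.

Lemma norm_Re_le z : `|complex.Re z| <= cnorm z.
Proof. by rewrite cnorm_def -sqrtr_sqr ler_wsqrtr // lerDl sqr_ge0. Qed.

Lemma norm_Im_le z : `|complex.Im z| <= cnorm z.
Proof. by rewrite cnorm_def -sqrtr_sqr ler_wsqrtr // lerDr sqr_ge0. Qed.

Lemma cnorm_le z : cnorm z <= `|complex.Re z| + `|complex.Im z|.
Proof.
rewrite [z in leLHS]complexE; apply: le_trans (cnormD _ _) _.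
by rewrite cnormM cnormi mul1r !cnorm_real.
Qed.

Lemma cnormB_ge z1 z2 : cnorm z1 - cnorm z2 <= cnorm (z1 + z2).
Proof.
by rewrite lerBlDr -(cnormN z2); apply: le_trans (cnormD _ _); rewrite addrK.
Qed.

Lemma logarithmic_derivative (K : fieldType) (rs : seq K) (c : K) :
  (forall y, y \in rs -> c != y) ->
  (\prod_(y <- rs) ('X - y%:P))^`().[c] =
  (\prod_(y <- rs) ('X - y%:P)).[c] * \sum_(y <- rs) (c - y)^-1.
Proof.
elim: rs => [|y rs IH] cy; first by rewrite !big_nil derivC horner0 mulr0.
rewrite !big_cons derivM derivXsubC mul1r hornerD !hornerM hornerXsubC IH; last first.
  by move=> x x_in; apply: cy; rewrite inE x_in orbT.
have : c - y != 0 by rewrite subr_eq0 cy // mem_head.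
by move=> cy0; field.
Qed.

(** The quotient f'(c) / f(c) is the sum of 1 / (c - z) over the n roots z. If each |c - z| exceeded
    n |f(c) / f'(c)|, this sum would have modulus less than |f'(c) / f(c)|. The product form covers
    f'(c) = 0. *)
Lemma monic_root_near (f : {poly R[i]}) c : f \is monic -> (1 < size f)%N ->
  exists2 z, root f z &
    cnorm (c - z) * cnorm f^`().[c] <= (size f).-1%:R * cnorm f.[c].
Proof.
move=> f_monic f_size; have [rs fE] := closed_field_poly_normal f.
rewrite (monicP f_monic) scale1r in fE.
have rs_size : size rs = (size f).-1 by rewrite fE size_prod_XsubC.
have rs_root z : z \in rs -> root f z by rewrite fE root_prod_XsubC.
have [/hasP[z z_rs /eqP cz]|/hasPn no_c] := boolP (has (fun z => c == z) rs).
  exists z; first exact: rs_root.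
  by rewrite cz subrr /cnorm normr0 mul0r mulr_ge0 ?ler0n ?cnorm_ge0.
pose near z := cnorm (c - z) * cnorm f^`().[c] <= (size f).-1%:R * cnorm f.[c].
have [/hasP[z z_rs z_near]|/hasPn far] := boolP (has near rs).
  by exists z => //; apply: rs_root.
have fc0 : 0 < cnorm f.[c].
  rewrite cnorm_gt0; apply/negP => /eqP /rootP.
  by rewrite fE root_prod_XsubC => /no_c; rewrite eqxx.
have n_gt0 : (0 < (size f).-1)%N by rewrite -subn1 subn_gt0.
(* The induction is over nonempty lists, as the strict inequality fails for the empty sum. *)
have sum_le s : {subset s <= rs} -> (0 < size s)%N ->
    (size f).-1%:R * cnorm f.[c] * cnorm (\sum_(z <- s) (c - z)^-1)
      < (size s)%:R * cnorm f^`().[c].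
  elim: s => // z s IH sub _; rewrite big_cons.
  have z_rs : z \in rs by apply: sub; rewrite mem_head.
  have cz : c - z != 0 by rewrite subr_eq0 no_c.
  have z_lt : (size f).-1%:R * cnorm f.[c] * cnorm (c - z)^-1 < cnorm f^`().[c].
    rewrite -(ltr_pM2l (_ : 0 < cnorm (c - z))) ?cnorm_gt0 //.
    rewrite mulrCA -cnormM divff // [cnorm 1]cnorm_real normr1 mulr1.
    by have := far _ z_rs; rewrite /near -ltNge.
  have -> : (size (z :: s))%:R = 1 + (size s)%:R :> R by rewrite /= -natr1 addrC.
  rewrite mulrDl mul1r; apply: le_lt_trans (ler_wpM2l _ (cnormD _ _)) _.
    by rewrite mulr_ge0 ?ler0n ?cnorm_ge0.
  rewrite mulrDr; case: s IH sub => [|y s] IH sub.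
    by rewrite big_nil [cnorm 0]cnorm_real normr0 mulr0 mul0r !addr0.
  apply: ltrD => //; apply: IH => // x xs; apply: sub; rewrite inE xs orbT //.
have := sum_le rs (fun x => id); rewrite rs_size => /(_ n_gt0).
rewrite -mulrA ltr_pM2l ?ltr0n // -cnormM [in X in _ < X]fE.
by rewrite logarithmic_derivative -?fE ?ltxx.
Qed.
End ComplexNorm.

(** * The four roots of W *)

Section Pair.
Variable R : rcfType.
Implicit Types (v z : R[i]) (x y e w : R).

(** The non-real roots are about 1.4764 + 0.460 i and its conjugate; bounding the square of the
    imaginary part covers both. *)
Definition pair_root_box v :=
  [&& 1 + 476 / 1000 + 35 / 100 / 1000 < complex.Re v,
      complex.Re v < 1 + 476 / 1000 + 37 / 100 / 1000,
      2115 / 1000 / 10 < complex.Im v ^+ 2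
    & complex.Im v ^+ 2 < 2118 / 1000 / 10].

Definition quartic_root_box v :=
  [|| (complex.Im v == 0) && negative_root_interval (complex.Re v),
      (complex.Im v == 0) && positive_root_interval (complex.Re v)
    | pair_root_box v].

(** Dividing W by its two real linear factors leaves v^2 + s v + t, with roots -s / 2 +- i sqrt(t -
    s^2 / 4). The real roots are known precisely enough to locate these. *)
Lemma quartic_roots : exists w0 w1 x y,
  [/\ negative_root_interval w0, positive_root_interval w1,
      pair_root_box (x +i* y)%C, 4598 / 1000 / 10 <= y
    & forall v, quartic v = 0 ->
        v \in [:: w0%:C%C; w1%:C%C; (x +i* y)%C; (x -i* y)%C]].
Proof.
have [w0 [w1 [r0 I0 r1 I1]]] := quartic_real_roots R.
move: (I0) (I1) => /andP[l0 u0] /andP[l1 u1].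
(* The divided difference of W at its roots [w0] and [w1] vanishes; it is the linear coefficient of
   the remainder of the division. *)
have D0 : w0 ^+ 3 + w0 ^+ 2 * w1 + w0 * w1 ^+ 2 + w1 ^+ 3 - 8 * (w0 + w1) + 12 = 0.
  apply: (mulfI (_ : w0 - w1 != 0)).
    by apply/negP => /eqP; clear - u0 l1; lra.
  rewrite mulr0 -[RHS](subrr 0) -[X in _ = X - _]r0 -[X in _ = _ - X]r1 /quartic.
  by ring.
pose s := w0 + w1; pose t := s ^+ 2 - w0 * w1 - 8.
have s_l : - (2 + 952 / 1000 + 73 / 100 / 1000) < s by rewrite /s; clear - l0 l1; lra.
have s_u : s < - (2 + 952 / 1000 + 71 / 100 / 1000) by rewrite /s; clear - u0 u1; lra.
have [d_l d_u] : 2115 / 1000 / 10 < t - s ^+ 2 / 4 /\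
    t - s ^+ 2 / 4 < 2118 / 1000 / 10.
  have p_l : - (1 + 672 / 1000 + 75 / 100 / 1000) < w0 * w1.
    by clear - l0 u0 l1 u1; nra.
  have p_u : w0 * w1 < - (1 + 672 / 1000 + 70 / 100 / 1000).
    by clear - l0 u0 l1 u1; nra.
  have [s2_l s2_u] : (2 + 952 / 1000 + 71 / 100 / 1000) ^+ 2 < s ^+ 2 /\
      s ^+ 2 < (2 + 952 / 1000 + 73 / 100 / 1000) ^+ 2.
    by clear - s_l s_u; split; nra.
  by rewrite /t; clear - p_l p_u s2_l s2_u; split; lra.
have d_ge0 : 0 <= t - s ^+ 2 / 4 by clear - d_l; lra.
pose y := Num.sqrt (t - s ^+ 2 / 4).
have yE : y ^+ 2 = t - s ^+ 2 / 4 by rewrite sqr_sqrtr.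
exists w0, w1, (- s / 2), y; split => //.
- by apply/and4P; split; rewrite ?[complex.Im _]/= ?yE // [complex.Re _]/=;
  clear - s_l s_u; lra.
- have y0 : 0 <= y := sqrtr_ge0 _; rewrite -yE in d_l; clear - y0 d_l; nra.
move=> v v_root.
have : (v - w0%:C%C) * (v - w1%:C%C) * (v ^+ 2 + s%:C%C * v + t%:C%C) = 0.
  rewrite -[RHS]v_root; apply/eqP; rewrite -subr_eq0; apply/eqP.
  transitivity (- (w0 ^+ 3 + w0 ^+ 2 * w1 + w0 * w1 ^+ 2 + w1 ^+ 3
      - 8 * (w0 + w1) + 12)%:C%C * (v - w0%:C%C) - (quartic w0)%:C%C).
    by rewrite /quartic /t /s; ring.
  by rewrite D0 r0 rmorph0 !oppr0 mul0r addr0.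
have -> : v ^+ 2 + s%:C%C * v + t%:C%C
    = (v - (- s / 2 +i* y)%C) * (v - (- s / 2 -i* y)%C).
  case: v {v_root} => a b; apply/eqP; rewrite eq_complex /=.
  have {}yE : t = y ^+ 2 + s ^+ 2 / 4 by rewrite yE subrK.
  by apply/andP; split; apply/eqP; rewrite ?yE; field.
by move/eqP; rewrite !mulf_eq0 !subr_eq0 !inE -orbA.
Qed.

Lemma quartic_rootP v : quartic v = 0 -> quartic_root_box v.
Proof.
have [w0 [w1 [x [y [I0 I1 box _ roots]]]]] := quartic_roots.
move=> /roots; rewrite !inE /quartic_root_box => /or4P[] /eqP->; apply/or3P.
- by apply/Or31; rewrite /= eqxx.
- by apply/Or32; rewrite /= eqxx.
- exact/Or33.
- by apply/Or33; move: box; rewrite /pair_root_box /= sqrrN.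
Qed.

(** The two conjugate roots are the closest, at distance about 0.92; all other pairs differ enough
    in their real parts. *)
Lemma quartic_roots_separated v v' : quartic v = 0 -> quartic v' = 0 -> v != v' ->
  9 / 10 <= cnorm (v - v').
Proof.
have [w0 [w1 [x [y [/andP[l0 u0] /andP[l1 u1] /and4P[xl xu _ _] yl roots]]]]] :=
  quartic_roots.
rewrite [complex.Re _]/= in xl xu.
have Re_sep z : 9 / 10 <= complex.Re z -> 9 / 10 <= cnorm z.
  by move=> zr; apply: le_trans (norm_Re_le _); apply: le_trans zr (ler_norm _).
have Im_sep z : 9 / 10 <= complex.Im z -> 9 / 10 <= cnorm z.
  by move=> zr; apply: le_trans (norm_Im_le _); apply: le_trans zr (ler_norm _).
have sym z z' : 9 / 10 <= cnorm (z - z') -> 9 / 10 <= cnorm (z' - z).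
  by rewrite -cnormN opprB.
move=> /roots; rewrite !inE => v_in /roots; rewrite !inE => v'_in.
have d01 : 9 / 10 <= cnorm (w1%:C%C - w0%:C%C).
  by apply: Re_sep; rewrite /=; clear - u0 l1; lra.
have d0 s : 9 / 10 <= cnorm ((x +i* s)%C - w0%:C%C).
  by apply: Re_sep; rewrite /=; clear - u0 xl; lra.
have d1 s : 9 / 10 <= cnorm ((x +i* s)%C - w1%:C%C).
  by apply: Re_sep; rewrite /=; clear - u1 xl; lra.
have d2 : 9 / 10 <= cnorm ((x +i* y)%C - (x -i* y)%C).
  by apply: Im_sep; rewrite /=; clear - yl; lra.
by case/or4P: v_in => /eqP->; case/or4P: v'_in => /eqP->; rewrite ?eqxx // => _;
  try exact: d01; try exact: d0; try exact: d1; try exact: d2; apply: sym;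
  try exact: d01; try exact: d0; try exact: d1; exact: d2.
Qed.

Lemma Z_ring_complex k : Z_ring R[i] k = (Z_ring R k)%:C%C.
Proof. by rewrite !Z_ringE rmorph_int. Qed.

(** Separating the parts brings the estimates into R; the factor y, of modulus about 0.46, stays in
    front of the imaginary part. *)
Lemma evq_complex x y a b c d : evq (x +i* y)%C (a, b, c, d) =
  ((Z_ring R a + Z_ring R b * x + Z_ring R c * (x ^+ 2 - y ^+ 2)
     + Z_ring R d * (x * (x ^+ 2 - 3 * y ^+ 2))) +i*
   (y * (Z_ring R b + 2 * Z_ring R c * x + Z_ring R d * (3 * x ^+ 2 - y ^+ 2))))%C.
Proof.
rewrite /evq !Z_ring_complex; apply/eqP; rewrite eq_complex /=.
by apply/andP; split; apply/eqP; ring.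
Qed.

Lemma cnorm_complex_le x y k M N : `|x| <= M -> `|y| * `|k| <= N ->
  cnorm (x +i* (y * k))%C <= M + N.
Proof.
by move=> xM ykN; apply: le_trans (cnorm_le _) _; rewrite /= normrM; apply: lerD.
Qed.
End Pair.

Section PairBounds.
Variable R : rcfType.

Lemma complex_le_cnorm (z : R[i]) (x : R) : (`|z| <= x%:C%C) = (cnorm z <= x).
Proof. by rewrite cnormE lecR. Qed.

Lemma cnorm_realXM (e : R) n (z : R[i]) :
  cnorm (e%:C%C ^+ n * z) = `|e| ^+ n * cnorm z.
Proof. by rewrite cnormM cnormX cnorm_real. Qed.

Lemma pair_root_norm (v : R[i]) : pair_root_box v -> 1000 * cnorm v <= 1547.
Proof.
case: v => x y /and4P[/= xl xu yl yu].
have c2 : cnorm (x +i* y)%C ^+ 2 = x ^+ 2 + y ^+ 2.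
  by rewrite cnorm_def sqr_sqrtr // addr_ge0 // sqr_ge0.
have := cnorm_ge0 (x +i* y)%C; set c := cnorm _ in c2 *; nra.
Qed.

(** Two coefficients are evaluated at the root and only the rest is left to the crude tail bound.
    The value is then at most 2000 + (46000 + 3.9 * 10^6) / 194 and the derivative at least 546 -
    (14700 + 4112) / 194, in units of |e|^6 and |e|^3. *)
Lemma pair_root_quint_bounds (v : R[i]) (e : R) : quartic v = 0 -> pair_root_box v ->
  194 * `|e| <= 1 ->
  cnorm (quint0 (1 + 2 * e%:C%C) (- center v e%:C%C ^+ 2)) <= 224 * 100 * `|e| ^+ 6 /\
  440 * `|e| ^+ 3 <= cnorm (quint1 (1 + 2 * e%:C%C) (- center v e%:C%C ^+ 2)).
Proof.
move=> v_root v_box e_le; have v_norm := pair_root_norm v_box.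
have v_le : Z_ring R[i] 1000 * `|v| <= Z_ring R[i] 1547.
  by rewrite cnormE !Z_ring_complex -rmorphM /= lecR; lra.
have e_le' : Z_ring R[i] 194 * `|e%:C%C| <= Z_ring R[i] 1.
  by rewrite cnormE cnorm_real !Z_ring_complex -rmorphM /= lecR; lra.
have [q0 q1 _ _ _] := ev_expr_quint v e%:C%C eT; rewrite ev_eT in q0 q1.
have [||r0] := @ev_expr_head R[i] v e%:C%C 1547 v_root (Zle_0_pos 1547) v_le e_le'
  (equint0 eT) 6
  [:: (-81920, 270336, -241664, 69632)%bZ; (2678784, -8818688, 7956480, -2326528)%bZ]
  755269681%bZ.
- by vm_compute.
- by vm_compute.
rewrite q0 [foldr _ _ _]/foldr Z_ring_complex complex_le_cnorm => -> r0_le {q0}.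
have [||r1] := @ev_expr_head R[i] v e%:C%C 1547 v_root (Zle_0_pos 1547) v_le e_le'
  (equint1 eT) 3
  [:: (1536, -2048, 0, 512)%bZ; (23040, -41984, 12288, 3584)%bZ] 797643%bZ.
- by vm_compute.
- by vm_compute.
rewrite q1 [foldr _ _ _]/foldr Z_ring_complex complex_le_cnorm => -> r1_le {q1}.
rewrite (cnorm_realXM e 6) (cnorm_realXM e 3) => {v_root v_le e_le' v_norm}.
case: v v_box => x y /and4P[xl xu yl yu].
rewrite [complex.Re _]/= in xl xu; rewrite [complex.Im _]/= in yl yu.
have [ny_l ny_u] : 4598 / 1000 / 10 <= `|y| /\ `|y| <= 4603 / 1000 / 10.
  rewrite -real_normK ?num_real // in yl yu.
  by have := normr_ge0 y; clear - yl yu; split; nra.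
have [x2_l x2_u] : 2 + 179 / 1000 + 6 / 10 / 1000 <= x ^+ 2 /\
    x ^+ 2 <= 2 + 179 / 1000 + 67 / 100 / 1000.
  by clear - xl xu; split; nra.
have e_ge0 := normr_ge0 e.
set t := x * (x ^+ 2 - 3 * y ^+ 2).
have [t_l t_u] : 2279 / 1000 <= t /\ t <= 2282 / 1000.
  have z_l : 1544 / 1000 <= x ^+ 2 - 3 * y ^+ 2 by clear - yu x2_l; lra.
  have z_u : x ^+ 2 - 3 * y ^+ 2 <= 1545 / 1000 + 2 / 10 / 1000 by clear - yl x2_u; lra.
  rewrite /t; set z := _ - _ in z_l z_u *; clear - xl xu z_l z_u; split; nra.
have Im_le (k N : R) : `|k| <= N -> `|y| * `|k| <= 4603 / 1000 / 10 * N.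
  by move=> kN; apply: ler_pM.
have c6 : cnorm (evq (x +i* y)%C (-81920, 270336, -241664, 69632)%bZ) <= 2000.
  rewrite evq_complex -/t.
  apply: le_trans (cnorm_complex_le (M := 700) _ (Im_le _ 2700 _)) _.
  - rewrite ler_norml /=; clear - xl xu yl yu x2_l x2_u t_l t_u.
    by apply/andP; split; lra.
  - rewrite ler_norml /=; clear - xl xu yl yu x2_l x2_u t_l t_u.
    by apply/andP; split; lra.
  - by clear; lra.
have c7 : cnorm (evq (x +i* y)%C
    (2678784, -8818688, 7956480, -2326528)%bZ) <= 46 * 1000.
  rewrite evq_complex -/t.
  apply: le_trans (cnorm_complex_le (M := 23 * 1000) _ (Im_le _ (48 * 1000) _)) _.
  - rewrite ler_norml /=; clear - xl xu yl yu x2_l x2_u t_l t_u.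
    by apply/andP; split; lra.
  - rewrite ler_norml /=; clear - xl xu yl yu x2_l x2_u t_l t_u.
    by apply/andP; split; lra.
  - by clear; lra.
have c4 : cnorm (evq (x +i* y)%C (23040, -41984, 12288, 3584)%bZ) <= 14 * 1000 + 700.
  rewrite evq_complex -/t.
  apply: le_trans
    (cnorm_complex_le (M := 6 * 1000 + 700) _ (Im_le _ (17 * 1000 + 200) _)) _.
  - rewrite ler_norml /=; clear - xl xu yl yu x2_l x2_u t_l t_u.
    by apply/andP; split; lra.
  - rewrite ler_norml /=; clear - xl xu yl yu x2_l x2_u t_l t_u.
    by apply/andP; split; lra.
  - by clear; lra.
(* This is 128 W'(v); its imaginary part alone is large enough. *)
have c3 : 546 <= cnorm (evq (x +i* y)%C (1536, -2048, 0, 512)%bZ).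
  rewrite evq_complex; apply: le_trans (norm_Im_le _); rewrite [complex.Im _]/= normrM.
  apply: (@le_trans _ _ (4598 / 1000 / 10 * 1189)); first by clear; lra.
  apply: ler_pM; [by clear; lra | exact: ler0n | exact: ny_l |].
  apply: le_trans (ler_norm _); rewrite /=.
  by clear - xl xu yl yu x2_l x2_u t_l t_u; lra.
have eta_le (a M : R) : 0 <= a -> a <= M -> 194 * (`|e| * a) <= M.
  by move=> a0 aM; apply: le_trans aM; rewrite mulrA -[leRHS]mul1r; apply: ler_wpM2r.
move: c6 c7 c3 c4.
set a6 := evq _ (-81920, _, _, _)%bZ; set a7 := evq _ (2678784, _, _, _)%bZ.
set a3 := evq _ (1536, _, _, _)%bZ; set a4 := evq _ (23040, _, _, _)%bZ.
move=> c6 c7 c3 c4; clearbody a6 a7 a3 a4.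
have b0 := eta_le _ _ (cnorm_ge0 _) r0_le; have b1 := eta_le _ _ (cnorm_ge0 _) r1_le.
have s0 : cnorm (a7 + e%:C%C * r0) <= cnorm a7 + `|e| * cnorm r0.
  by apply: le_trans (cnormD _ _) _; rewrite (cnormM e%:C%C) cnorm_real.
have s1 : cnorm (a4 + e%:C%C * r1) <= cnorm a4 + `|e| * cnorm r1.
  by apply: le_trans (cnormD _ _) _; rewrite (cnormM e%:C%C) cnorm_real.
have b0' := eta_le _ _ (cnorm_ge0 _) s0; have b1' := eta_le _ _ (cnorm_ge0 _) s1.
split.
  rewrite mulrC; apply: ler_wpM2r; first exact: exprn_ge0.
  apply: le_trans (cnormD _ _) _; rewrite (cnormM e%:C%C) cnorm_real.
  by rewrite /= in b0; clear - c6 c7 b0 b0'; lra.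
rewrite mulrC; apply: ler_wpM2l; first exact: exprn_ge0.
apply: le_trans (cnormB_ge _ _); rewrite (cnormM e%:C%C) cnorm_real.
by rewrite /= in b1; clear - c3 c4 b1 b1'; lra.
Qed.
End PairBounds.

(** * The quintic as a monic polynomial in T *)

Definition quint_poly (K : comNzRingType) (p : K) : {poly K} :=
  'X^5 + ((2 + p ^+ 2) * (3 - 2 * p ^+ 2)) *: 'X^4
  + (1 + 10 * p ^+ 2 + 4 * p ^+ 4 - 14 * p ^+ 6 + p ^+ 8) *: 'X^3
  + (- (p ^+ 2 * (1 - 14 * p ^+ 2 + 4 * p ^+ 4 + 10 * p ^+ 6 + p ^+ 8))) *: 'X^2
  + (- (p ^+ 6 * (1 + 2 * p ^+ 2) * (3 * p ^+ 2 - 2))) *: 'X + (- p ^+ 10)%:P.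

Lemma horner_quint_poly (K : comNzRingType) (p T : K) :
  (quint_poly p).[T] = quint0 p T.
Proof.
by rewrite /quint_poly !(hornerD, hornerZ, hornerXn, hornerX, hornerC).
Qed.

Lemma horner_deriv_quint_poly (K : comNzRingType) (p T : K) :
  (quint_poly p)^`().[T] = quint1 p T.
Proof.
rewrite /quint_poly !(derivD, derivZ, derivXn, derivX, derivC) /=.
rewrite !(hornerD, hornerZ, hornerMn, hornerXn, hornerX, hornerC, horner0).
by rewrite /quint1; ring.
Qed.

Lemma size_quint_poly (K : comNzRingType) (p : K) : size (quint_poly p) = 6%N.
Proof.
rewrite /quint_poly -!addrA size_polyDl size_polyXn //.
do 3!(apply: leq_ltn_trans (size_polyD _ _) _; rewrite gtn_max;
  rewrite (leq_ltn_trans (size_scale_leq _ _)) ?size_polyXn //=).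
apply: leq_ltn_trans (size_polyD _ _) _; rewrite gtn_max.
rewrite (leq_ltn_trans (size_scale_leq _ _)) ?size_polyX //=.
exact: leq_ltn_trans (size_polyC_leq1 _) _.
Qed.

Lemma quint_poly_monic (K : comNzRingType) (p : K) : quint_poly p \is monic.
Proof.
apply/monicP; rewrite lead_coefE size_quint_poly /quint_poly.
by rewrite !(coefD, coefZ, coefXn, coefX, coefC) /= !mulr0 !addr0.
Qed.

(** * A root of the quintic near every center *)

Section RootNear.
Variable R : rcfType.
Implicit Types (v z : R[i]) (e : R).

Lemma cnorm_nat n : cnorm (n%:R : R[i]) = n%:R.
Proof. by rewrite -(rmorph_nat (real_complex R)) cnorm_real normr_nat. Qed.

Lemma center_sub1_le v e : cnorm v <= 344 / 100 -> 194 * `|e| <= 1 ->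
  cnorm (center v e%:C%C - 1) <= 1 / 10.
Proof.
move=> v_le e_le; have v0 := cnorm_ge0 v; have e0 := normr_ge0 e.
have -> : center v e%:C%C - 1
    = 2 * v * e%:C%C + 2 * (v ^+ 2 - v) * e%:C%C ^+ 2 by rewrite /center; ring.
apply: (@le_trans _ _ (2 * cnorm v * `|e|
    + 2 * (cnorm v ^+ 2 + cnorm v) * `|e| ^+ 2)).
  apply: le_trans (cnormD _ _) _.
  rewrite (cnormM (2 * v)) (cnormM 2 v) (cnormM (2 * _)) (cnormM 2 (_ - _)).
  rewrite cnormX cnorm_real cnorm_nat lerD2l.
  rewrite ler_wpM2r ?exprn_ge0 // ler_wpM2l //.
  by apply: le_trans (cnormD _ _) _; rewrite cnormN cnormX.
have ve : cnorm v * `|e| <= 344 / 100 / 194 by nra.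
have ve0 : 0 <= cnorm v * `|e| by rewrite mulr_ge0.
have ve2 : (cnorm v * `|e|) ^+ 2 <= 1 / 1000 by nra.
have vee : cnorm v * `|e| ^+ 2 <= 1 / 1000 by nra.
by lra.
Qed.

(** A root T near -X^2 comes from [monic_root_near]. For z^2 = T, the product of z - i X and z + i X
    is T + X^2, so an estimate for z follows once z + i X is bounded away from 0. *)
Lemma pair_root_near v e : quartic v = 0 -> pair_root_box v ->
  194 * `|e| <= 1 -> e != 0 -> exists2 z,
  quint0 (1 + 2 * e%:C%C) (z ^+ 2) = 0 &
  cnorm (z - 'i%C * center v e%:C%C) < 408 * `|e| ^+ 3.
Proof.
move=> v_root v_box e_le e0.
have [a0_le a1_ge] := pair_root_quint_bounds v_root v_box e_le.
set X := center v e%:C%C in a0_le a1_ge *.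
have v_le : cnorm v <= 1547 / 1000 by have := pair_root_norm v_box; lra.
have e_gt0 : 0 < `|e| by rewrite normr_gt0.
have X_ge : 9 / 10 <= cnorm X.
  have X1 := @center_sub1_le v e (le_trans v_le _) e_le.
  rewrite -[X](subrK 1) addrC; apply: le_trans (cnormB_ge _ _).
  rewrite [cnorm 1]cnorm_real normr1 lerBrDr -lerBrDl.
  by apply: le_trans (X1 _) _; lra.
have [||T T_root T_near] := @monic_root_near R (quint_poly (1 + 2 * e%:C%C)) (- X ^+ 2).
- exact: quint_poly_monic.
- by rewrite size_quint_poly.
rewrite size_quint_poly horner_quint_poly horner_deriv_quint_poly in T_near.
rewrite rootE horner_quint_poly in T_root.
(* Of the two square roots of T, z is the one nearer to i X; hence |z + i X| >= |X| >= 9/10. *)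
have [z z2 z_close] : exists2 z, z ^+ 2 = T &
    cnorm (z - 'i%C * X) <= cnorm (z + 'i%C * X).
  pose z := sqrtc T; have z2 : z ^+ 2 = T by rewrite sqr_sqrtc.
  have [le|lt] := leP (cnorm (z - 'i%C * X)) (cnorm (z + 'i%C * X)); first by exists z.
  exists (- z); first by rewrite sqrrN.
  by rewrite -cnormN -[cnorm (- z + _)]cnormN !opprD !opprK ltW.
exists z; first by rewrite z2; apply/eqP.
have X_le : cnorm X <= cnorm (z + 'i%C * X).
  have : cnorm (2 * ('i%C * X)) <= cnorm (z + 'i%C * X) + cnorm (z - 'i%C * X).
    rewrite -[cnorm (z - _)]cnormN; apply: le_trans (cnormD _ _).
    by rewrite le_eqVlt; apply/orP; left; apply/eqP; congr cnorm; ring.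
  rewrite !cnormM cnormi mul1r cnorm_nat.
  by clear - z_close; lra.
have prodE : cnorm (z - 'i%C * X) * cnorm (z + 'i%C * X) = cnorm (- X ^+ 2 - T).
  rewrite -cnormM -z2 -[RHS]cnormN; congr cnorm.
  transitivity (z ^+ 2 - 'i%C ^+ 2 * X ^+ 2); first by ring.
  by rewrite sqr_i; ring.
rewrite -prodE in T_near; set d := cnorm (z - 'i%C * X) in T_near *.
have d0 : 0 <= d := cnorm_ge0 _.
set a1 := cnorm (quint1 _ _) in a1_ge T_near.
set a0 := cnorm (quint0 _ _) in a0_le T_near.
set b := cnorm (z + _) in X_le T_near.
have e3 : 0 < `|e| ^+ 3 by exact: exprn_gt0.
(* The factor 5 is the degree; 5 * 22400 / (0.9 * 440) < 283 is well below 408. *)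
have step : d * (9 / 10) * (440 * `|e| ^+ 3) <= 5 * (224 * 100 * `|e| ^+ 6).
  apply: (@le_trans _ _ (5 * a0)); last by rewrite ler_wpM2l.
  apply: le_trans T_near; apply: ler_pM => //.
  - by rewrite mulr_ge0 //; lra.
  - by rewrite mulr_ge0 // ltW.
  - by apply: ler_wpM2l => //; apply: le_trans X_ge X_le.
have : d * 396 * `|e| ^+ 3 <= 112 * 1000 * `|e| ^+ 3 * `|e| ^+ 3.
  move: step; set m := `|e| ; rewrite (_ : m ^+ 6 = m ^+ 3 * m ^+ 3); last by ring.
  by clear; lra.
rewrite ler_pM2r //; clear - e3; lra.
Qed.

Lemma quint_root_near v e : quartic v = 0 ->
  194 * `|e| <= 1 -> e != 0 -> exists2 z,
  quint0 (1 + 2 * e%:C%C) (z ^+ 2) = 0 &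
  cnorm (z - 'i%C * center v e%:C%C) < 408 * `|e| ^+ 3.
Proof.
move=> v_root e_le e0; have v_box := quartic_rootP v_root.
have [/pair_root_near|] := boolP (pair_root_box v); first exact.
case: v v_root v_box => w im v_root; rewrite /quartic_root_box orbA -andb_orr.
move=> /orP[/andP[/eqP im0 wI]|->] // _.
rewrite [complex.Im _]/= in im0; rewrite [complex.Re _]/= in wI.
rewrite im0 -[(w +i* 0)%C]/w%:C%C in v_root *.
have w_root : quartic w = 0.
  by apply: (@complexI R); rewrite -[RHS]v_root /quartic; ring.
have [y [y0 y_near y_root]] := imaginary_axis_root w_root wI e_le e0.
exists ('i%C * y%:C%C).
  have -> : ('i%C * y%:C%C) ^+ 2 = (- y ^+ 2)%:C%C :> R[i].
    by rewrite exprMn sqr_i; ring.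
  have -> : 1 + 2 * e%:C%C = (1 + 2 * e)%:C%C :> R[i] by ring.
  by rewrite -[RHS](rmorph0 (real_complex R)) -y_root /quint0; ring.
have -> : center w%:C%C e%:C%C = (center w e)%:C%C :> R[i] by rewrite /center; ring.
by rewrite -mulrBr cnormM cnormi mul1r -rmorphB /= cnorm_real.
Qed.
End RootNear.

(** * Counting the roots *)

Lemma mup_prod_XsubC_uniq (F : fieldType) (rs : seq F) x :
  uniq rs -> x \in rs -> mup x (\prod_(z <- rs) ('X - z%:P)) = 1%N.
Proof.
move=> rs_uniq x_rs; rewrite (perm_big _ (perm_to_rem x_rs)) big_cons /=.
rewrite mupMl; last by rewrite root_prod_XsubC mem_rem_uniq // inE eqxx.
by have := mup_XsubCX 1 x x; rewrite expr1 eqxx.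
Qed.

Lemma Qpoly_lower (K : comNzRingType) (p q : K) :
  exists2 g : {poly K}, Qpoly p q = 'X^10 + g & (size g <= 9)%N.
Proof.
have sizeZ (c : K) n : (n <= 8)%N -> (size (c *: 'X^n) <= 9)%N.
  by move=> n8; apply: leq_trans (size_scale_leq _ _) _; rewrite size_polyXn.
have sizeB (f g : {poly K}) : (size f <= 9)%N -> (size g <= 9)%N ->
    (size (f - g)%R <= 9)%N.
  by move=> fs gs; apply: leq_trans (size_polyD _ _) _; rewrite size_polyN geq_max fs.
rewrite /Qpoly -!addrA; eexists; first reflexivity; rewrite !addrA.
apply: (sizeB); last exact: leq_trans (size_polyC_leq1 _) _.
do 2!(apply: (sizeB); last exact: sizeZ).
by apply: leq_trans (size_polyD _ _) _; rewrite geq_max !sizeZ.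
Qed.

Lemma size_Qpoly (K : comNzRingType) (p q : K) : size (Qpoly p q) = 11%N.
Proof.
have [g -> g_size] := Qpoly_lower p q.
by rewrite size_polyDl size_polyXn // ltnS (leq_trans g_size).
Qed.

Lemma Qpoly_monic (K : comNzRingType) (p q : K) : Qpoly p q \is monic.
Proof.
have [g gE g_size] := Qpoly_lower p q.
apply/monicP; rewrite lead_coefE size_Qpoly gE coefD coefXn /=.
by rewrite nth_default ?addr0 // (leq_trans g_size).
Qed.

(** Q is homogeneous of degree 20 when p and q have weight 1 and t has weight 2. *)
Lemma horner_Qpoly (K : fieldType) (p q z : K) : q != 0 -> (2 : K) != 0 ->
  (Qpoly (p + q) q).[z] = q ^+ 20 * quint0 (1 + 2 * (p / (2 * q))) ((z / q ^+ 2) ^+ 2).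
Proof.
move=> q0 two0.
rewrite /Qpoly !(hornerD, hornerN, hornerZ, hornerXn, hornerX, hornerC) /quint0.
by field; rewrite q0 two0.
Qed.

Lemma horner_QpolyN (K : comNzRingType) (p q z : K) :
  (Qpoly p q).[- z] = (Qpoly p q).[z].
Proof.
rewrite /Qpoly !(hornerD, hornerN, hornerZ, hornerXn, hornerX, hornerC).
by ring.
Qed.

Section Upper.
Variable R : realType.
Implicit Types z : R[i].

Lemma upper_opp z : upper z -> ~ upper (- z).
Proof. by case: z => x y; rewrite /upper /= => -[[]|[]] ? ? -[[]|[]]; lra. Qed.

Lemma upper_Im_gt0 z : 0 < complex.Im z -> upper z.
Proof. by move=> z0; right; split=> //; lra. Qed.

(** The n roots and their opposites are 2 n distinct roots of a polynomial of degree 2 n, which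
    therefore is the product of the corresponding linear factors. *)
Lemma even_poly_upper_roots n (f : {poly R[i]}) (t : 'I_n -> R[i]) :
  size f = n.*2.+1 -> f \is monic -> (forall z, f.[- z] = f.[z]) ->
  injective t -> (forall k, root f (t k)) -> (forall k, upper (t k)) ->
  (forall z, (root f z /\ upper z) <-> exists k, z = t k) /\
  forall k, mup (t k) f = 1%N.
Proof.
move=> f_size f_monic f_even t_inj t_root t_upper.
pose rs := codom t ++ map -%R (codom t).
have rs_in z : z \in rs -> exists k, z = t k \/ z = - t k.
  rewrite mem_cat => /orP[/codomP[k ->]|/mapP[_ /codomP[k ->] ->]].
    by exists k; left.
  by exists k; right.
have rs_uniq : uniq rs.
  have t_uniq : uniq (codom t) by apply/injectiveP.
  rewrite cat_uniq t_uniq (map_inj_uniq (@oppr_inj _)) t_uniq andbT /=.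
  apply/hasPn => _ /mapP[_ /codomP[k ->] ->]; apply/negP => /codomP[j tE].
  by have := upper_opp (t_upper k); rewrite tE; apply.
have rs_root : all (root f) rs.
  apply/allP => z /rs_in[k [] ->]; first exact: t_root.
  by rewrite rootE f_even; apply: t_root.
have fE : f = \prod_(z <- rs) ('X - z%:P).
  rewrite [LHS](all_roots_prod_XsubC _ rs_root) ?uniq_rootsE //.
    by rewrite (monicP f_monic) scale1r.
  by rewrite f_size size_cat (size_map -%R) size_codom card_ord addnn.
split=> [z|k]; last first.
  by rewrite fE; apply: mup_prod_XsubC_uniq => //; rewrite mem_cat codom_f.
split=> [[z_root z_upper]|[k ->]]; last by split.
have : z \in rs by rewrite -root_prod_XsubC -fE.
move=> /rs_in[k [|zE]]; first by exists k.
by case: (upper_opp z_upper); rewrite zE opprK.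
Qed.
End Upper.

(** * The polynomial of the u_k and the substitution u = i v *)

Lemma horner_upoly (R : realType) (u : R[i]) : (upoly R).[u] = quartic (- 'i%C * u).
Proof.
rewrite /upoly !(hornerD, hornerN, hornerZ, hornerXn, hornerX, hornerC) /quartic.
transitivity (('i%C ^+ 2) ^+ 2 * u ^+ 4 - 8 * ('i%C ^+ 2 * u ^+ 2)
  - 12 * 'i%C * u - 4); last by ring.
by rewrite sqr_i; ring.
Qed.

(** The polynomial is coprime to its derivative, so the given u_k are pairwise distinct. *)
Lemma upoly_roots_uniq (R : realType) (us : seq R[i]) :
  upoly R = \prod_(u <- us) ('X - u%:P) -> uniq us.
Proof.
move=> uE; rewrite -separable_prod_XsubC -uE unlock.
apply: Pdiv.ClosedField.root_coprimep => u; rewrite !rootE horner_upoly => /eqP u_root.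
apply/negP => /eqP.
rewrite /upoly !(derivD, derivN, derivZ, derivXn, derivX, derivC) /=.
rewrite !(hornerD, hornerN, hornerZ, hornerMn, hornerXn, hornerX, hornerC,
  horner0) => d_root.
pose v := - 'i%C * u.
have uv : u = 'i%C * v by rewrite /v mulNr mulrN mulrA -expr2 sqr_i mulN1r opprK.
have dv : v ^+ 3 - 4 * v + 3 = 0.
  apply: (mulfI (_ : - 4 * 'i%C != 0 :> R[i])).
    rewrite mulf_neq0 ?oppr_eq0 ?pnatr_eq0 //.
    by rewrite -(sqrf_eq0 'i%C) sqr_i oppr_eq0 oner_eq0.
  rewrite mulr0 -[RHS]d_root uv.
  transitivity (4 * 'i%C ^+ 2 * 'i%C * v ^+ 3 + 16 * 'i%C * v - 12 * 'i%C).
    by rewrite sqr_i; ring.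
  by ring.
(* Euclid's algorithm for W and D = W' / 4 = v^3 - 4 v + 3: the remainders are W - v D = -4 v^2 + 9
   v - 4, then v + 12 up to scaling, then 688. *)
have /eqP : 688 = (16 * (v ^+ 3 - 4 * v + 3) + (4 * v + 9) *
    (quartic v - v * (v ^+ 3 - 4 * v + 3))) * (57 - 4 * v)
    - (quartic v - v * (v ^+ 3 - 4 * v + 3)).
  by rewrite /quartic; ring.
by rewrite dv u_root !mulr0 subrr mulr0 addr0 mul0r subrr pnatr_eq0.
Qed.

Lemma interval_root (R : rcfType) (e : R) : 194 * `|e| <= 1 -> e != 0 ->
  exists2 x, quint0 (1 + 2 * e) (x ^+ 2) = 0 &
    let a := 1 + 10 * e + 40 * e ^+ 2 in
    if 0 < e then a - 592 * e ^+ 3 < x < a else a < x < a - 592 * e ^+ 3.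
Proof.
move=> e_le e0; set a := 1 + 10 * e + 40 * e ^+ 2.
(* Expressions are evaluated over a root of W, so one is supplied. *)
have [w [_ [w_root /andP[wl wu] _ _]]] := quartic_real_roots R.
have w_le : 1000 * `|w| <= 3440 by rewrite ltr0_norm; clear - wl wu; lra.
have [s1 s2] := real_interval_signs w_root w_le e_le e0.
rewrite -/a in s1 s2.
pose f : {poly R} := quint_poly (1 + 2 * e) \Po 'X^2.
have fE x : f.[x] = quint0 (1 + 2 * e) (x ^+ 2).
  by rewrite /f horner_comp horner_quint_poly hornerXn.
have sgn : f.[a] * f.[a - 592 * e ^+ 3] < 0.
  rewrite !fE; move: s1 s2; set y := quint0 _ _; set z := quint0 _ _ => s1 s2.
  have : (e * y) * (e * z) < 0 by rewrite pmulr_rlt0.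
  by rewrite mulrACA pmulr_rlt0 // -expr2 exprn_even_gt0.
have [ep|en] := ltP 0 e.
  have e3 : 0 < e ^+ 3 by exact: exprn_gt0.
  rewrite mulrC in sgn.
  have [|x xI fx] := poly_ivt_strict _ sgn; last by exists x; rewrite -?fE.
  by clear - e3; lra.
have e3 : e ^+ 3 <= 0 by rewrite exprn_odd_le0.
have [|x xI fx] := poly_ivt_strict _ sgn; last by exists x; rewrite -?fE.
by clear - e3; lra.
Qed.

(** * Rescaling by q~^2: the sets I and D_u in terms of e *)

Section Scaling.
Variables (R : realType) (p q : int).
Hypotheses (p_neq0 : p <> 0) (q_gt0 : 0 < q) (q_ge : 97 * `|p| <= q).

Local Notation pr := (p%:~R : R).
Local Notation qr := (q%:~R : R).
Let e : R := pr / (2 * qr).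
Let scale (z : R[i]) : R[i] := (qr ^+ 2)%:C%C * z.

Let qr_gt0 : 0 < qr. Proof. by rewrite ltr0z. Qed.
Let qr2_gt0 : 0 < qr ^+ 2. Proof. exact: exprn_gt0. Qed.
Let qr_neq0 : qr != 0. Proof. exact: lt0r_neq0. Qed.

Lemma scaled_neq0 : e != 0.
Proof.
rewrite /e mulf_neq0 ?invr_eq0 ?mulf_neq0 ?pnatr_eq0 // intr_eq0.
exact/eqP.
Qed.

Lemma scaled_norm : `|e| = `|pr| / (2 * qr).
Proof. by rewrite /e normrM normfV [`|2 * _|]gtr0_norm // mulr_gt0. Qed.

Lemma scaled_le : 194 * `|e| <= 1.
Proof.
rewrite scaled_norm mulrA ler_pdivrMr ?mulr_gt0 // mul1r.
have : (97 * `|p|)%:~R <= qr by rewrite ler_int.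
by rewrite intrM intr_norm; lra.
Qed.

Lemma scaled_gt0 : (0 < e) = (0 < p).
Proof. by rewrite /e pmulr_lgt0 ?invr_gt0 ?mulr_gt0 // ltr0z. Qed.

Lemma scaleK z : scale (z / (qr ^+ 2)%:C%C) = z.
Proof. by rewrite /scale mulrC divfK // (fmorph_eq0 (real_complex R)) gt_eqF. Qed.

Lemma root_P z : root (P R p q) (scale z) <-> quint0 (1 + 2 * e%:C%C) (z ^+ 2) = 0.
Proof.
have q0 : q%:~R != 0 :> R[i] by rewrite intr_eq0 gt_eqF.
have two0 : 2 != 0 :> R[i] by rewrite pnatr_eq0.
have eE : e%:C%C = p%:~R / (2 * q%:~R) :> R[i].
  by rewrite /e fmorph_div rmorphM /= !rmorph_int rmorph_nat.
rewrite rootE /P intrD horner_Qpoly // -eE.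
have -> : scale z / q%:~R ^+ 2 = z.
  by rewrite /scale rmorphXn /= rmorph_int mulrC mulKf // expf_neq0.
rewrite mulf_eq0 expf_eq0 (negbTE q0) andbF /=.
by split => [/eqP|->].
Qed.

(** The radius 51 |p~|^3 / q~ divided by q~^2 is 51 * 8 |e|^3. *)
Lemma DsetE u z : Dset p q u (scale z) <->
  cnorm (z - 'i%C * center (- 'i%C * u) e%:C%C) < 408 * `|e| ^+ 3.
Proof.
rewrite /Dset /= cnormE ltcR.
have q0 : q%:~R != 0 :> R[i] by rewrite intr_eq0 gt_eqF.
have eE : e%:C%C = p%:~R / (2 * q%:~R) :> R[i].
  by rewrite /e fmorph_div rmorphM /= !rmorph_int rmorph_nat.
have -> : scale z - 'i%C * q%:~R ^+ 2 - u * p%:~R * q%:~R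
    + (u + 'i%C * u ^+ 2) / 2 * p%:~R ^+ 2
  = scale (z - 'i%C * center (- 'i%C * u) e%:C%C).
  rewrite /scale rmorphXn /= rmorph_int /center eE.
  (* [field] treats i as a variable, so the signs due to i^2 = -1 are first written out. *)
  transitivity (q%:~R ^+ 2 * z - 'i%C * q%:~R ^+ 2 + 'i%C ^+ 2 * u * p%:~R * q%:~R
    - ('i%C ^+ 2 * u + 'i%C ^+ 2 * 'i%C * u ^+ 2) / 2 * p%:~R ^+ 2).
    by rewrite sqr_i; field.
  by field; rewrite q0.
rewrite /scale cnormM cnorm_real gtr0_norm //.
have -> : 51 * err R p q = qr ^+ 2 * (408 * `|e| ^+ 3).
  by rewrite /err scaled_norm; field; rewrite qr_neq0.
by rewrite ltr_pM2l.
Qed.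

(** In both cases the ends of I are q~^2 a and q~^2 (a - 592 e^3), with 592 = 8 * 74; the sign of e
    decides their order. *)
Lemma Iset_scale x :
  (let a := 1 + 10 * e + 40 * e ^+ 2 in
   if 0 < e then a - 592 * e ^+ 3 < x < a else a < x < a - 592 * e ^+ 3) ->
  Iset p q (scale x%:C%C).
Proof.
have aE : A R p q = qr ^+ 2 * (1 + 10 * e + 40 * e ^+ 2).
  by rewrite /A /e; field; rewrite qr_neq0.
rewrite /= scaled_gt0 /Iset; case: ifPn => p0 /andP[x_l x_u];
  exists (qr ^+ 2 * x); rewrite /= ?in_itv /= /scale -?rmorphM //.
  have eE : 74 * err R p q = qr ^+ 2 * (592 * e ^+ 3).
    have /gtr0_norm e_norm : 0 < e by rewrite scaled_gt0.
    rewrite -[e in RHS]e_norm.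
    by rewrite /err scaled_norm; field; rewrite qr_neq0.
  by rewrite aE eE -mulrBr !ltr_pM2l // x_l.
have eE : 74 * err R p q = - (qr ^+ 2 * (592 * e ^+ 3)).
  have /ler0_norm e_norm : e <= 0 by rewrite leNgt scaled_gt0.
  rewrite -[e in RHS]opprK -e_norm.
  by rewrite /err scaled_norm; field; rewrite qr_neq0.
by rewrite aE eE -mulrBr !ltr_pM2l // x_l.
Qed.

(** In both cases I lies above A - 74 |p~|^3 / q~, which is q~^2 times a number close to 1. *)
Lemma Iset_real_gt0 (t : R[i]) : Iset p q t -> complex.Im t = 0 /\ 0 < complex.Re t.
Proof.
have A_gt0 : 0 < A R p q - 74 * err R p q.
  have -> : A R p q - 74 * err R p q
     = qr ^+ 2 * (1 + 10 * e + 40 * e ^+ 2 - 592 * `|e| ^+ 3).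
    by rewrite /A /err scaled_norm /e; field; rewrite qr_neq0.
  have e_le := scaled_le; have e_ge0 := normr_ge0 e.
  have /andP[e_l e_u] : - (1 / 194) <= e <= 1 / 194 by rewrite -ler_norml; lra.
  have e3 : `|e| ^+ 3 <= (1 / 194) ^+ 3 by apply: lerXn2r; rewrite ?nnegrE; lra.
  rewrite mulr_gt0 //; have := sqr_ge0 e; lra.
have err_ge0 : 0 <= err R p q by rewrite /err divr_ge0 ?exprn_ge0 // ltW.
by rewrite /Iset; case: ifP => _ [x /= /[!in_itv]/= /andP[x_l x_u] <-] /=; split => //;
  lra.
Qed.
End Scaling.

(** * Position of the rescaled discs *)

Section Discs.
Variables (R : rcfType) (e : R).
Implicit Types v z : R[i].
Hypotheses (e_le : 194 * `|e| <= 1) (e_neq0 : e != 0).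

Lemma quartic_root_norm v : quartic v = 0 -> cnorm v <= 344 / 100.
Proof.
move=> /quartic_rootP; case: v => x y.
move=> /or3P[/andP[]|/andP[]|/pair_root_norm]; last by lra.
  move=> /= /eqP-> /andP[l u]; rewrite [cnorm _]cnorm_real ltr0_norm; lra.
move=> /= /eqP-> /andP[l u]; rewrite [cnorm _]cnorm_real gtr0_norm; lra.
Qed.

(** Every center is within 1/10 of i, and the radius is far smaller. *)
Lemma disc_Im_gt0 v z : quartic v = 0 ->
  cnorm (z - 'i%C * center v e%:C%C) < 408 * `|e| ^+ 3 -> 0 < complex.Im z.
Proof.
move=> /quartic_root_norm v_le z_near; have el := e_le.
have w_le := center_sub1_le v_le e_le.
have e3 : `|e| ^+ 3 <= (1 / 194) ^+ 3.
  by apply: lerXn2r; rewrite ?nnegrE //; lra.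
have -> : z = 'i%C + ('i%C * (center v e%:C%C - 1) + (z - 'i%C * center v e%:C%C)).
  by ring.
set d := _ + (z - _); have d_le : cnorm d < 1 / 2.
  apply: le_lt_trans (cnormD _ _) _; rewrite cnormM cnormi mul1r; lra.
have := le_trans (norm_Im_le d) (ltW d_le); rewrite ler_norml => /andP[d_l _].
have -> : complex.Im ('i%C + d) = 1 + complex.Im d by case: (d).
by lra.
Qed.

(** The centers differ by 2 i e (v - v') (1 + e (v + v' - 1)), of modulus at least 1.62 |e|, while
    the two radii add up to 816 |e|^3. *)
Lemma discs_disjoint v v' z : quartic v = 0 -> quartic v' = 0 ->
  cnorm (z - 'i%C * center v e%:C%C) < 408 * `|e| ^+ 3 ->
  cnorm (z - 'i%C * center v' e%:C%C) < 408 * `|e| ^+ 3 -> v = v'.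
Proof.
move=> v_root v'_root z_v z_v'; apply/eqP/negP => /negP vv'.
have sep := quartic_roots_separated v_root v'_root vv'.
have v_le := quartic_root_norm v_root; have v'_le := quartic_root_norm v'_root.
have e_gt0 : 0 < `|e| by rewrite normr_gt0.
have el := e_le.
pose c := 1 + e%:C%C * (v + v' - 1).
have c_ge : 9 / 10 <= cnorm c.
  apply: le_trans (cnormB_ge _ _); rewrite cnormM cnorm_real.
  have -> : cnorm (1 : R[i]) = 1 by rewrite [cnorm 1]cnorm_real normr1.
  have : cnorm (v + v' - 1) <= 8.
    apply: le_trans (cnormD _ _) _; rewrite cnormN [cnorm 1]cnorm_real normr1.
    have := cnormD v v'; lra.
  have := cnorm_ge0 (v + v' - 1); nra.
have diff : cnorm ('i%C * center v e%:C%C - 'i%C * center v' e%:C%C)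
    = 2 * `|e| * (cnorm (v - v') * cnorm c).
  have -> : 'i%C * center v e%:C%C - 'i%C * center v' e%:C%C
      = 'i%C * (2 * e%:C%C * ((v - v') * c)) by rewrite /center /c; ring.
  rewrite (cnormM 'i%C) cnormi mul1r (cnormM (2 * _)) (cnormM 2 _) cnorm_nat.
  by rewrite cnorm_real (cnormM (v - v')).
have diff_lt : 2 * `|e| * (cnorm (v - v') * cnorm c) < 816 * `|e| ^+ 3.
  rewrite -diff.
  have -> : 'i%C * center v e%:C%C - 'i%C * center v' e%:C%C
    = (z - 'i%C * center v' e%:C%C) + - (z - 'i%C * center v e%:C%C) by ring.
  apply: le_lt_trans (cnormD _ _) _; rewrite cnormN; lra.
have prod_ge : 81 / 100 <= cnorm (v - v') * cnorm c.
  by apply: le_trans (ler_pM _ _ sep c_ge); lra.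
have : `|e| * (81 / 100 * 2) < `|e| * (816 * `|e| ^+ 2).
  apply: le_lt_trans (_ : _ <= 2 * `|e| * (cnorm (v - v') * cnorm c)) _.
    rewrite (_ : 2 * `|e| * _ = `|e| * (2 * (cnorm (v - v') * cnorm c))); last by ring.
    by rewrite ler_pM2l //; lra.
  by apply: lt_le_trans diff_lt _; rewrite le_eqVlt; apply/orP; left; apply/eqP; ring.
rewrite ltr_pM2l //.
have : `|e| ^+ 2 <= (1 / 194) ^+ 2 by apply: lerXn2r; rewrite ?nnegrE; lra.
by lra.
Qed.
End Discs.

Theorem theorem6p1 (R : realType) (p q : int) (u2 u3 u4 u5 : R[i])
    (p_neq0 : p <> 0) (q_gt0 : 0 < q) (q_ge : 97 * `|p| <= q)
    (u_roots : upoly R =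
       ('X - u2%:P) * ('X - u3%:P) * ('X - u4%:P) * ('X - u5%:P)) :
  trivIset setT (region p q u2 u3 u4 u5) /\
  exists t : 'I_5 -> R[i],
    [/\ injective t,
        forall z : R[i], (root (P R p q) z /\ upper z) <-> exists k, z = t k,
        forall k, mup (t k) (P R p q) = 1%N
      & forall j k, region p q u2 u3 u4 u5 k (t j) <-> j = k].
Proof.
pose us := [:: u2; u3; u4; u5].
have usE : upoly R = \prod_(u <- us) ('X - u%:P).
  by rewrite u_roots /us !big_cons big_nil mulr1 !mulrA.
have us_uniq := upoly_roots_uniq usE.
have us_root u : u \in us -> quartic (- 'i%C * u) = 0.
  move=> u_us; rewrite -horner_upoly; apply/rootP.
  by rewrite usE root_prod_XsubC.
pose e : R := p%:~R / (2 * q%:~R).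
have e_le : 194 * `|e| <= 1 := scaled_le R q_gt0 q_ge.
have e0 : e != 0 := scaled_neq0 R p_neq0 q_gt0.
have regionE (k : 'I_5) : region p q u2 u3 u4 u5 k =
    if (k : nat) is j.+1 then Dset p q (nth 0 us j) else Iset p q.
  by case: k => [[|[|[|[|[|k]]]]] hk].
have Dnear u t : Dset p q u t -> cnorm (t / (q%:~R ^+ 2)%:C%C
    - 'i%C * center (- 'i%C * u) e%:C%C) < 408 * `|e| ^+ 3.
  by rewrite -{1}(scaleK q_gt0 t) => /(DsetE p q_gt0).
have us_lt j : (j.+1 < 5)%N -> nth 0 us j \in us by move=> hj; apply: mem_nth.
have D_Im u t : u \in us -> Dset p q u t -> 0 < complex.Im t.
  move=> /us_root u_root /Dnear /(disc_Im_gt0 e_le u_root).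
  rewrite -[X in _ -> 0 < complex.Im X](scaleK q_gt0 t); set z := t / _.
  case: z => a b /= b0; rewrite mul0r addr0.
  by rewrite mulr_gt0 // exprn_gt0 // ltr0z.
have i0 : - 'i%C != 0 :> R[i].
  by rewrite oppr_eq0 -(sqrf_eq0 'i%C) sqr_i oppr_eq0 oner_eq0.
have triv : trivIset setT (region p q u2 u3 u4 u5).
  (* I lies on the real axis and the discs above it; two discs that meet belong to the same v, hence
     to the same index since the u_k are distinct. *)
  move=> j k _ _ [t []]; rewrite !regionE; case: j k => [[|j] hj] [[|k] hk] /=.
  - by move=> _ _; apply: val_inj.
  - move=> /(Iset_real_gt0 q_gt0 q_ge)[im _] /(D_Im _ _ (us_lt _ hk)).
    by rewrite im ltxx.
  - move=> /(D_Im _ _ (us_lt _ hj)) + /(Iset_real_gt0 q_gt0 q_ge)[im _].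
    by rewrite im ltxx.
  - move=> /Dnear tj /Dnear tk; apply: val_inj => /=; congr _.+1.
    have := discs_disjoint e_le e0 (us_root _ (us_lt _ hj))
      (us_root _ (us_lt _ hk)) tj tk.
    by move=> /(mulfI i0)/eqP; rewrite nth_uniq // => /eqP.
split=> //.
have region_root k : exists t, region p q u2 u3 u4 u5 k t /\ root (P R p q) t.
  rewrite regionE; case: k => [[|k] hk] /=.
    have [x x_root xI] := interval_root e_le e0.
    exists ((q%:~R ^+ 2)%:C%C * x%:C%C); split.
      exact: (Iset_scale q_gt0 xI).
    apply/(root_P p q_gt0); rewrite -[RHS](rmorph0 (real_complex R)) -x_root.
    by rewrite /quint0 -/e; ring.
  have [z z_root z_near] := quint_root_near (us_root _ (us_lt _ hk)) e_le e0.
  exists ((q%:~R ^+ 2)%:C%C * z); split; first exact/(DsetE p q_gt0).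
  exact/(root_P p q_gt0).
have [t tP] := choice region_root.
have t_upper k : upper (t k).
  have := (tP k).1; rewrite regionE; case: k => [[|k] hk] /=.
    by move=> /(Iset_real_gt0 q_gt0 q_ge); left.
  by move=> /(D_Im _ _ (us_lt _ hk)); apply: upper_Im_gt0.
(* Disjointness makes the region of a chosen root unique, which also gives injectivity of t. *)
have t_region j k : region p q u2 u3 u4 u5 k (t j) <-> j = k.
  split=> [tjk|->]; last exact: (tP k).1.
  by apply: triv => //; exists (t j); split; [exact: (tP j).1|].
have t_inj : injective t.
  by move=> j k tjk; apply/t_region; rewrite tjk; exact: (tP k).1.
(* Five upper roots suffice: P is even, monic and of degree 10. *)
have [roots simple] := @even_poly_upper_roots R 5 _ t (size_Qpoly _ _) (Qpoly_monic _ _)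
  (@horner_QpolyN _ _ _) t_inj (fun k => (tP k).2) t_upper.
by exists t; split.
Qed.
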